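(* Suppose that $Z$ has the compound Poisson distribution $\mathrm{CP}(\lambda,Q)$, where $\lambda>0$ and $Q=(Q_j)_{j\ge1}$ is a probability measure on $\mathbb{N}=\{1,2,\ldots\}$ with finite moments up to order $L$, $$L=\sup\Big\{\tau\ge 1:\ \sum_{j\ge1}j^{\tau}Q_j<\infty\Big\}>1,$$ and write $q_1=\sum_{j\ge1}j\,Q_j$ for its first moment. (i) If $f:\mathbb{Z}_+\to\mathbb{R}$ is $K$-Lipschitz, then for any $t>0$ and $\epsilon>0$ we have $$\Pr\big\{|f(Z)-E[f(Z)]|>t\big\}\;\le\;\exp\bigg\{\inf_{0<\alpha<L}\Big[I_\epsilon(\alpha)+\alpha\log\Big(\frac{2|f(0)|+2K\lambda q_1+\epsilon}{t}\Big)\Big]\bigg\},$$ where $$I_\epsilon(\alpha)=\lambda\sum_{j\ge1}Q_j\big\{C_{j,\epsilon}^{\alpha}-1-\alpha\log C_{j,\epsilon}\big\},\qquad C_{j,\epsilon}=1+\frac{jK}{\epsilon}.$$ (ii) The upper bound in (i) is meaningful (less than $1$) if and only if $t>T:=2|f(0)|+2K\lambda q_1+\epsilon$, and then $$\Pr\big\{|f(Z)-E[f(Z)]|>t\big\}\;\le\;\exp\bigg\{-\int_0^{\log(t/T)}i_\epsilon^{-1}(s)\,ds\bigg\},$$ where $i_\epsilon^{-1}$ is the inverse of the function $i_\epsilon(\alpha):=I_\epsilon'(\alpha)=\lambda\sum_{j\ge1}Q_j\,[C_{j,\epsilon}^{\alpha}-1]\log C_{j,\epsilon}$.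
   Context: $\mathbb{Z}_+=\{0,1,2,\ldots\}$. For $\lambda>0$ and a probability measure $Q=(Q_j)_{j\ge1}$ on $\mathbb{N}=\{1,2,\ldots\}$ (with $Q_j=Q(\{j\})$), $\mathrm{CP}(\lambda,Q)$ is the law on $\mathbb{Z}_+$ of the random sum $\sum_{i=1}^{W}X_i$ (equal to $0$ when $W=0$), where $W\sim\mathrm{Poisson}(\lambda)$ and $X_1,X_2,\ldots$ are independent with law $Q$, and independent of $W$. For a constant $K$, a function $f:\mathbb{Z}_+\to\mathbb{R}$ is $K$-Lipschitz if $|f(j+1)-f(j)|\le K$ for all $j\in\mathbb{Z}_+$. *)

(* Defs.v *)
From HB Require Import structures.
From mathcomp Require Export all_boot all_order all_algebra.
From mathcomp Require Export all_classical all_reals all_analysis.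

Set Implicit Arguments.
Unset Strict Implicit.
Unset Printing Implicit Defensive.

Export Order.TTheory GRing.Theory Num.Theory.
Export numFieldNormedType.Exports.

Local Open Scope classical_set_scope.
Local Open Scope ring_scope.

(* Every subset of nat is measurable, so A ranges over all sets. *)
Definition mutually_independent (R : realType) (d : measure_display)
    (T : measurableType d) (P : probability T R)
    (Y : nat -> {RV P >-> nat}) : Prop :=
  forall (J : seq nat) (A : nat -> set nat), uniq J ->
    P (\bigcap_(i in [set` J]) (Y i @^-1` A i)) =
    (\prod_(i <- J) P (Y i @^-1` A i))%E.

(* mu is the law of X_0 + ... + X_(W-1), for some probability space carrying
   mutually independent W ~ Poisson(lambda) and X_i ~ Q. *)
Definition is_compound_poisson (R : realType) (lambda : R)
    (Q : probability nat R) (mu : set nat -> \bar R) : Prop :=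
  exists (d : measure_display) (T : measurableType d) (P : probability T R)
         (W : {RV P >-> nat}) (X : nat -> {RV P >-> nat}),
    [/\ forall n, P (W @^-1` [set n]) = (poisson_pmf lambda n)%:E,
        forall i A, P (X i @^-1` A) = Q A,
        @mutually_independent R d T P
          (fun k => if k is i.+1 then X i else W) &
        forall A : set nat,
          mu A = P [set w | A (\sum_(i < W w) X i w)%N]].

Definition lipschitz_nat (R : realType) (K : R) (f : nat -> R) : Prop :=
  forall j, `|f j.+1 - f j| <= K.

Section compound_poisson_quantities.
Context {R : realType}.
Implicit Types (lambda K eps alpha tau s : R) (Q : probability nat R).

Definition prob_mass Q (j : nat) : R := fine (Q [set j]).

Definition moment Q tau : \bar R :=
  (\sum_(1 <= j <oo) (j%:R `^ tau * prob_mass Q j)%:E)%E.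

Definition moment_order Q : \bar R :=
  ereal_sup [set tau%:E | tau in [set tau : R |
    1 <= tau /\ (moment Q tau < +oo)%E]].

Definition first_moment Q : R := fine (moment Q 1).

Definition Cconst K eps (j : nat) : R := 1 + j%:R * K / eps.

(* All terms are nonnegative; for alpha < moment_order Q the sum is finite,
   and fine only takes its real value. *)
Definition Ieps lambda Q K eps alpha : R :=
  lambda * fine (\sum_(1 <= j <oo)
    (prob_mass Q j * (Cconst K eps j `^ alpha - 1
                      - alpha * ln (Cconst K eps j)))%:E)%E.

Definition ieps lambda Q K eps : R -> R := derive1 (Ieps lambda Q K eps).

(* Inverse of ieps on [0, L[, where L := moment_order Q.  When L is finite,
   ieps may be bounded on [0, L[; the supremum extends the inverse by the
   value L beyond the range of ieps. *)
Definition ieps_inv lambda Q K eps s : \bar R :=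
  ereal_sup [set alpha%:E | alpha in [set alpha : R |
    [/\ 0 <= alpha, (alpha%:E < moment_order Q)%E &
        ieps lambda Q K eps alpha <= s]]].

Definition threshold lambda Q K eps (f : nat -> R) : R :=
  2 * `|f 0%N| + 2 * K * lambda * first_moment Q + eps.

Definition polynomial_bound lambda Q K eps (f : nat -> R) (t : R) : \bar R :=
  expeR (ereal_inf [set
    (Ieps lambda Q K eps alpha
     + alpha * ln (threshold lambda Q K eps f / t))%:E | alpha in
    [set alpha : R | 0 < alpha /\ (alpha%:E < moment_order Q)%E]]).

End compound_poisson_quantities.

(* Main.v *)
Require Import Defs.
From mathcomp Require Import ring lra measurable_realfun.

(* Fix [0 < a < L] and let [g = ln (F / eps)] with [F z = |f z - E f| + eps].  The
   increments of [g] are bounded: [|g (z + j) - g z| <= c j := ln (1 + j K / eps)].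
   If [X] has law [Q] and [h] is small, the variable equal to [X] with probability [h]
   and to [0] otherwise satisfies
     E (expR (a g (z + .))) <= expR (h Psi + a E (g (z + .))),
     Psi := E (expR (a c X) - 1 - a c X),
   because [1 + v <= expR v] and because [expR u - 1 - u <= expR v - 1 - v] whenever
   [|u| <= v].  Bounded increments are preserved by averaging, so the inequality can be
   iterated [n] times; letting [n] go to infinity with [n h -> lambda] (binomial to
   Poisson) yields [E (expR (a g Z)) <= expR (lambda Psi + a E (g Z))], and
   [lambda Psi = Ieps a].  The tangent to the logarithm at the threshold [T] bounds
   [E (g Z)] by [ln (T / eps)], and Markov's inequality gives (i).

   For (ii), [Ieps] is convex with derivative [ieps] and [Ieps a = o(a)] at [0].
   Write [J] for the inverse of [ieps] and [G s := sup_a (a s - Ieps a)].  Convexity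
   alone gives [e J(s) + G(s) <= G(s + e)] for [e > 0], so the Riemann sums of [J]
   over [[0, x]] telescope and the integral of [J] is at most [G x]. *)

Set Implicit Arguments.
Unset Strict Implicit.
Unset Printing Implicit Defensive.

Local Open Scope classical_set_scope.
Local Open Scope ring_scope.

(** * Compound Poisson laws and Poisson mixtures of convolution powers *)

Section integral_on_nat.
Context {R : realType}.
Local Open Scope ereal_scope.

Lemma ge0_integral_nat (mu : {measure set nat -> \bar R}) (F : nat -> \bar R) :
  (forall j, 0 <= F j) ->
  \int[mu]_j F j = \sum_(j <oo) F j * mu [set j].
Proof.
move=> F0.
have -> : [set: nat] = \bigcup_k [set k] by apply/seteqP; split => // x _; exists x.
rewrite ge0_integral_bigcup//; last by move=> i j _ _ [x [-> ->]].
apply: eq_eseriesr => j _.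
rewrite (eq_integral (cst (F j))) ?integral_cst// => x.
by rewrite inE => ->.
Qed.

End integral_on_nat.

(* [iter k shift_mean F x] is the expectation of [F (x + X_1 + ... + X_k)]. *)
Section shift_mean.
Context {R : realType} (Q : probability nat R).
Local Open Scope ereal_scope.
Implicit Types (F G : nat -> \bar R) (x j k : nat).

Definition shift_mean F x : \bar R := \int[Q]_j F (x + j)%N.

Lemma iter_shift_mean_ge0 k F : (forall x, 0 <= F x) ->
  forall x, 0 <= iter k shift_mean F x.
Proof.
by move=> F0; elim: k => //= k IH x; apply: integral_ge0.
Qed.

Lemma le_iter_shift_mean k F G : (forall x, 0 <= F x) ->
  (forall x, F x <= G x) ->
  forall x, iter k shift_mean F x <= iter k shift_mean G x.
Proof.
move=> F0 FG; elim: k => //= k IH x; apply: ge0_le_integral => //.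
by move=> j _; exact: iter_shift_mean_ge0.
Qed.

Lemma iter_shift_meanZ k (r : \bar R) F : 0 <= r -> (forall x, 0 <= F x) ->
  iter k shift_mean (fun x => r * F x) = (fun x => r * iter k shift_mean F x).
Proof.
move=> r0 F0; elim: k => //= k ->; apply/funext => x.
by rewrite /shift_mean ge0_integralZl// => j _; exact: iter_shift_mean_ge0.
Qed.

Lemma iter_shift_mean_series k (F : nat -> nat -> \bar R) :
  (forall n x, 0 <= F n x) ->
  iter k shift_mean (fun x => \sum_(n <oo) F n x) =
  (fun x => \sum_(n <oo) iter k shift_mean (F n) x).
Proof.
move=> F0; elim: k => //= k ->; apply/funext => x.
by rewrite /shift_mean integral_nneseries// => n j _; exact: iter_shift_mean_ge0.
Qed.

End shift_mean.

(** * Law of the random sum as a Poisson mixture *)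

Section compound_poisson_law.
Context {R : realType}.
Local Open Scope ereal_scope.

Let ind (B : set nat) (x : nat) : \bar R := (\1_B x)%:E.

Lemma measurable_partial_sum d (T : measurableType d) (P : probability T R)
    (Y : nat -> {RV P >-> nat}) m (C : set nat) :
  measurable [set w | C (\sum_(i < m) Y i.+1 w)%N].
Proof.
have msum k : measurable_fun setT (fun w => \sum_(i < k) Y i.+1 w)%N.
  elim: k => [|k IHk].
    by under eq_fun do rewrite big_ord0; exact: measurable_cst.
  under eq_fun do rewrite big_ord_recr/=.
  exact: measurable_fun_addn.
by rewrite -[X in measurable X]setTI; exact: msum.
Qed.

(** Induction on [m], splitting on the value [b] of the last summand. The event that [Y m.+1] equals
    [b] is absorbed into the intersection over [J], which is why [J] and [A] are arbitrary here;
    what remains is a shorter sum started at [x + b]. *)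
Lemma probability_partial_sum (Q : probability nat R) d (T : measurableType d)
    (P : probability T R) (Y : nat -> {RV P >-> nat}) :
  @mutually_independent R d T P Y ->
  (forall i A, P (Y i.+1 @^-1` A) = Q A) ->
  forall m (J : seq nat) (A : nat -> set nat) (B : set nat) (x : nat),
    uniq J -> (forall i, (0 < i <= m)%N -> i \notin J) ->
    P ([set w | B (x + \sum_(i < m) Y i.+1 w)%N] `&`
       \bigcap_(i in [set` J]) (Y i @^-1` A i)) =
    iter m (shift_mean Q) (ind B) x * \prod_(i <- J) P (Y i @^-1` A i).
Proof.
move=> indY YQ.
have mY i (A : set nat) : measurable (Y i @^-1` A).
  by rewrite -[_ @^-1` _]setTI; exact: measurable_funP.
have mJ (J : seq nat) (A : nat -> set nat) :
    measurable (\bigcap_(i in [set` J]) (Y i @^-1` A i)).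
  by apply: bigcap_measurableType => i _; exact: mY.
elim=> [|m IH] J A B x uJ dJ.
  rewrite /= /ind indicE.
  have -> : [set w : T | B (x + \sum_(i < 0) Y i.+1 w)%N] =
            (if x \in B then setT else set0).
    apply/seteqP; split => w /=; rewrite big_ord0 addn0.
      by move=> Bx; rewrite mem_set.
    by case: ifPn => //; rewrite inE.
  case: ifPn => xB; last by rewrite set0I measure0 mul0e.
  by rewrite setTI mul1e indY.
pose A' b := (fun i => if i == m.+1 then [set b] else A i) : nat -> set nat.
pose J' := m.+1 :: J.
have mJ' : m.+1 \notin J by apply: dJ; rewrite leqnn.
have uJ' : uniq J' by rewrite /= mJ'.
have dJ' i : (0 < i <= m)%N -> i \notin J'.
  move=> /andP[i0 im]; rewrite in_cons negb_or; apply/andP; split.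
    by rewrite neq_ltn ltnS im.
  by apply: dJ; rewrite i0 ltnW.
pose E b := [set w | B (x + b + \sum_(i < m) Y i.+1 w)%N] `&`
  \bigcap_(i in [set` J']) (Y i @^-1` A' b i).
have A'J b i : i \in J -> A' b i = A i.
  rewrite /A'; case: eqP => // -> imJ.
  by rewrite imJ in mJ'.
have mE b : measurable (E b).
  apply: measurableI; last exact: mJ.
  exact: (measurable_partial_sum _ _ (fun n => B (x + b + n)%N)).
have -> : [set w | B (x + \sum_(i < m.+1) Y i.+1 w)%N] `&`
       \bigcap_(i in [set` J]) (Y i @^-1` A i) = \bigcup_b E b.
  apply/seteqP; split => w /=.
    move=> [Bw Jw]; exists (Y m.+1 w) => //; split => /=.
      by move: Bw; rewrite big_ord_recr/= addnA addnAC.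
    move=> i /=; rewrite in_cons => /orP[/eqP ->|iJ].
      by rewrite /A' eqxx.
    by rewrite A'J//; apply: Jw.
  move=> [b _ [/= Bw Jw]]; split.
    have := Jw m.+1; rewrite /= in_cons eqxx /A' eqxx => /(_ isT) /= Yb.
    by rewrite big_ord_recr/= Yb addnA addnAC.
  move=> i /= iJ.
  by have := Jw i; rewrite /= in_cons iJ orbT A'J// => /(_ isT).
rewrite measure_bigcup//; last first.
  move=> a b _ _ [w [[_ wa] [_ wb]]].
  have := wa m.+1; rewrite /= in_cons eqxx /A' eqxx => /(_ isT) /= <-.
  by have := wb m.+1; rewrite /= in_cons eqxx /A' eqxx => /(_ isT) /= <-.
rewrite (eq_eseriesl (Q := xpredT)); last by move=> i; rewrite mem_set.
rewrite [X in _ = X * _]/= /shift_mean ge0_integral_nat; last first.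
  by move=> j; apply: iter_shift_mean_ge0 => y; rewrite lee_fin.
set p := \prod_(i <- J) P (Y i @^-1` A i).
have p0 : 0 <= p by exact: prode_ge0.
have pfin : p \is a fin_num.
  by apply: prode_fin_num => i _; exact: fin_num_measure.
rewrite -(fineK pfin) muleC -nneseriesZl//; last first.
  by move=> j _; rewrite mule_ge0//; apply: iter_shift_mean_ge0 => y; rewrite lee_fin.
apply: eq_eseriesr => b _.
transitivity (iter m (shift_mean Q) (ind B) (x + b)%N * (Q [set b] * p)).
  rewrite -[LHS]/(P (E b)) /E IH// /J' big_cons /A' eqxx YQ.
  by congr (_ * (_ * _)); apply: eq_big_seq => i iJ; rewrite -[in RHS](A'J b).
by rewrite fineK// [RHS]muleC -muleA.
Qed.

(** For an indicator, split on the value of [W] and use independence with [J] reduced to the index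
    of [W]. A general [phi] is a series of weighted singleton indicators, and nonnegativity allows
    all interchanges. *)
Lemma ge0_integral_compound_poisson (Q : probability nat R) (lambda : R)
    (mu : {measure set nat -> \bar R}) (phi : nat -> R) :
  (0 < lambda)%R -> is_compound_poisson lambda Q mu ->
  (forall x, 0 <= phi x)%R ->
  \int[mu]_x (phi x)%:E =
  \sum_(k <oo) (poisson_pmf lambda k)%:E * iter k (shift_mean Q) (EFin \o phi) 0%N.
Proof.
move=> lambda0 [d [T [P [W [X [WP XQ indWX muE]]]]]] phi0.
pose Y k : {RV P >-> nat} := if k is i.+1 then X i else W.
have YW k (A : set nat) : measurable (Y k @^-1` A).
  by rewrite -[_ @^-1` _]setTI; exact: measurable_funP.
have muA (A : set nat) : mu A =
    \sum_(k <oo) (poisson_pmf lambda k)%:E * iter k (shift_mean Q) (ind A) 0%N.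
  rewrite muE.
  pose E k := [set w | A (0 + \sum_(i < k) Y i.+1 w)%N] `&`
    \bigcap_(i in [set` [:: 0%N]]) (Y i @^-1` [set k]).
  have EW k w : E k w <-> A (\sum_(i < k) X i w)%N /\ W w = k.
    split => [[/= Aw /(_ 0%N)]|[Aw Wk]].
      by rewrite /= inE eqxx => /(_ isT).
    by split => // i; rewrite /= ?inE ?orbF => /eqP ->.
  have -> : [set w | A (\sum_(i < W w) X i w)%N] = \bigcup_k E k.
    apply/seteqP; split => w /=.
      by move=> Aw; exists (W w) => //; apply/EW.
    by move=> [k _ /EW[Aw ->]].
  rewrite measure_bigcup//.
  - rewrite (eq_eseriesl (Q := xpredT)); last by move=> i; rewrite mem_set.
    apply: eq_eseriesr => k _.
    rewrite -[LHS]/(P (E k)) /E (@probability_partial_sum Q _ _ P Y)//.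
      by rewrite big_seq1 muleC WP.
    by move=> i; rewrite inE => /andP[i0 _]; rewrite -lt0n.
  - move=> k _; apply: measurableI; last first.
      by apply: bigcap_measurableType => i _; exact: YW.
    exact: (measurable_partial_sum Y k (fun n => A (0 + n)%N)).
  - by move=> a b _ _ [w [/EW[_ <-] /EW[_ <-]]].
rewrite ge0_integral_nat//.
have ind0 z y : 0 <= (phi z)%:E * ind [set z] y by rewrite -EFinM lee_fin mulr_ge0.
have phiE : EFin \o phi = (fun x => \sum_(z <oo) (phi z)%:E * ind [set z] x).
  apply/funext => x.
  rewrite (nneseriesD1 (n := x))// eseries0 ?adde0 => [|z _ /= zx].
    by rewrite /ind indicE mem_set// mule1.
  by rewrite /ind indicE memNset ?mule0// => xz; rewrite xz eqxx in zx.
have p0 k : (0 <= poisson_pmf lambda k)%R by exact: poisson_pmf_ge0.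
have T0 k z x : 0 <= iter k (shift_mean Q) (ind [set z]) x.
  by apply: iter_shift_mean_ge0 => y; rewrite lee_fin.
transitivity (\sum_(z <oo) \sum_(k <oo)
    (poisson_pmf lambda k)%:E * ((phi z)%:E * iter k (shift_mean Q) (ind [set z]) 0%N)).
  apply: eq_eseriesr => z _; rewrite muA -nneseriesZl//; last first.
    by move=> k _; rewrite mule_ge0// lee_fin.
  by apply: eq_eseriesr => k _; rewrite muleCA.
rewrite nneseries_interchange//; last by move=> *; rewrite !mule_ge0// lee_fin.
apply: eq_eseriesr => k _.
rewrite nneseriesZl//; last by move=> *; rewrite !mule_ge0// lee_fin.
rewrite phiE iter_shift_mean_series//; congr (_ * _); apply: eq_eseriesr => z _.
by rewrite iter_shift_meanZ// ?lee_fin// => x; rewrite lee_fin.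
Qed.

End compound_poisson_law.

(** * Exponential moments of functions with bounded increments *)

Section exponential_remainder.
Context {R : realType}.
Implicit Types u v w : R.

Definition expR_rem u : R := expR u - 1 - u.

Lemma expR_rem_ge0 u : 0 <= expR_rem u.
Proof. by rewrite /expR_rem -addrA -opprD subr_ge0 expR_ge1Dx. Qed.

(** Mean value theorem: the derivative [expR z + expR (- z)] is at least 2 because it exceeds 2 by
    [(expR z - 1) ^+ 2 / expR z]. *)
Lemma expR_subNr_ge w : 0 <= w -> 2 * w <= expR w - expR (- w).
Proof.
move=> w0.
have df (x : R) : is_derive x 1 (fun x : R => expR x - expR (- x) : R) (expR x + expR (- x)).
  by apply: is_derive_eq; rewrite /GRing.scale/=; ring.
have [|z z0] := @MVT_segment R _ (fun x => expR x + expR (- x)) _ _ w0.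
  apply: derivable_within_continuous => x _.
  exact: (@ex_derive _ _ _ _ _ _ _ (df x)).
rewrite oppr0 expR0 subrr subr0 addr0 => ->; apply: (ler_wpM2r w0).
have := expR_gt0 z; rewrite expRN => e0.
rewrite -subr_ge0 [leRHS](_ : _ = (expR z - 1) ^+ 2 / expR z); last by field; lra.
by rewrite divr_ge0 ?sqr_ge0// ltW.
Qed.

(** The remainder increases on the nonnegative half-line, and for [w >= 0] its value at [- w] is at
    most its value at [w] by [expR_subNr_ge]. *)
Lemma le_expR_rem u v : `|u| <= v -> expR_rem u <= expR_rem v.
Proof.
move=> uv.
have mono w : 0 <= w <= v -> expR_rem w <= expR_rem v.
  move=> /andP[w0 wv]; rewrite /expR_rem.
  have e1 : 1 <= expR w by have := expR_ge1Dx w; lra.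
  have e2 : 1 + (v - w) <= expR (v - w) by exact: expR_ge1Dx.
  have -> : expR v = expR w * expR (v - w) by rewrite -expRD; congr expR; ring.
  nra.
have [u0|/ltW u0] := leP 0 u; first by apply: mono; rewrite u0 -(ger0_norm u0).
apply: le_trans (mono (- u) _); last by rewrite oppr_ge0 u0 -(ler0_norm u0).
by have := @expR_subNr_ge (- u); rewrite oppr_ge0 opprK /expR_rem => /(_ u0); lra.
Qed.

(** By [N], the remainder is at most [u * (expR u - 1)]; a second linear bound on [expR u - 1] gives
    the square. *)
Lemma expR_rem_le_sqr u : expR_rem u <= u ^+ 2 * expR `|u|.
Proof.
have N (x : R) : expR x - 1 <= x * expR x.
  have := expR_ge1Dx (- x); have := expR_gt0 x; rewrite expRN => e0 e1.
  have := ler_wpM2r (ltW e0) e1; rewrite mulVf ?gt_eqF//; lra.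
have e1 := expR_ge1Dx u.
rewrite /expR_rem.
have [u0|/ltW u0] := leP 0 u.
  rewrite ger0_norm//; have := N u; have := ler_wpM2l u0 (N u); rewrite expr2; lra.
rewrite ler0_norm//.
have := N u => N1.
have e0 : 1 <= expR (- u) by have := expR_ge1Dx (- u); lra.
have : u * (expR u - 1) <= u ^+ 2 by rewrite expr2; nra.
have : u ^+ 2 <= u ^+ 2 * expR (- u) by rewrite ler_peMr// sqr_ge0.
lra.
Qed.

End exponential_remainder.

(** * Lazy random walk and binomial weights *)

Section lazy_shift_mean.
Context {R : realType} (Q : probability nat R).
Implicit Types (F : nat -> \bar R) (x j k n : nat) (h : R).

Definition lazy_shift_mean h F x : \bar R :=
  ((1 - h)%:E * F x + h%:E * shift_mean Q F x)%E.

Lemma le_lazy_shift_mean h F G : 0 <= h <= 1 -> (forall x, 0 <= F x)%E ->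
  (forall x, F x <= G x)%E ->
  forall x, (lazy_shift_mean h F x <= lazy_shift_mean h G x)%E.
Proof.
move=> /andP[h0 h1] F0 FG x; apply: leeD; apply: lee_wpmul2l => //.
- by rewrite lee_fin subr_ge0.
- exact: (@le_iter_shift_mean _ Q 1).
Qed.

Lemma iter_lazy_shift_mean_ge0 h n F : 0 <= h <= 1 -> (forall x, 0 <= F x)%E ->
  forall x, (0 <= iter n (lazy_shift_mean h) F x)%E.
Proof.
move=> /andP[h0 h1] F0; elim: n => //= n IH x; rewrite /lazy_shift_mean.
rewrite adde_ge0// mule_ge0// ?lee_fin ?subr_ge0//.
exact: (@iter_shift_mean_ge0 _ Q 1).
Qed.

Definition binomial_weight h n k : R := 'C(n, k)%:R * (1 - h) ^+ (n - k) * h ^+ k.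

Lemma binomial_weight_ge0 h n k : 0 <= h <= 1 -> 0 <= binomial_weight h n k.
Proof. by move=> /andP[h0 h1]; rewrite !mulr_ge0// exprn_ge0// subr_ge0. Qed.

Lemma binomial_weightS h n k :
  binomial_weight h n.+1 k.+1 =
  (1 - h) * binomial_weight h n k.+1 + h * binomial_weight h n k.
Proof.
rewrite /binomial_weight binS natrD subSS exprS.
have [nk|kn] := leqP n k; first by rewrite bin_small//; ring.
by rewrite -(subnSK kn) exprS; ring.
Qed.

(** Among [n] lazy steps the number of actual jumps is binomial; the induction is Pascal's rule
    [binomial_weightS]. *)
Lemma iter_lazy_shift_mean h n F x : 0 <= h <= 1 -> (forall x, 0 <= F x)%E ->
  iter n (lazy_shift_mean h) F x =
  (\sum_(k < n.+1) (binomial_weight h n k)%:E * iter k (shift_mean Q) F x)%E.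
Proof.
move=> h01 F0.
have /andP[h0 h1] := h01; have h1' : 0 <= 1 - h by rewrite subr_ge0.
have b0 m k := @binomial_weight_ge0 h m k h01.
have T0 k y : (0 <= iter k (shift_mean Q) F y)%E by exact: iter_shift_mean_ge0.
have bT0 m k y : (0 <= (binomial_weight h m k)%:E * iter k (shift_mean Q) F y)%E.
  by rewrite mule_ge0// lee_fin.
elim: n x => [|n IH] x.
  by rewrite big_ord1/= /binomial_weight bin0 !expr0 !mulr1 mul1e.
have splitE k y : ((binomial_weight h n.+1 k.+1)%:E * y =
    (1 - h)%:E * ((binomial_weight h n k.+1)%:E * y) +
    h%:E * ((binomial_weight h n k)%:E * y))%E.
  rewrite binomial_weightS EFinD ge0_muleDl ?lee_fin; first by rewrite !EFinM !muleA.
  - by rewrite mulr_ge0// b0.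
  - by rewrite mulr_ge0// b0.
have stepE : (shift_mean Q (iter n (lazy_shift_mean h) F) x =
    \sum_(k < n.+1) (binomial_weight h n k)%:E * iter k.+1 (shift_mean Q) F x)%E.
  rewrite [LHS]/shift_mean (funext IH) ge0_integral_sum//.
  by apply: eq_bigr => k _; rewrite ge0_integralZl// lee_fin.
rewrite iterS [LHS]/lazy_shift_mean stepE IH.
rewrite !ge0_sume_distrr//; last first.
  by move=> i _; apply: mule_ge0; [rewrite lee_fin; exact: b0|exact: T0].
rewrite [RHS]big_ord_recl.
under [X in _ = (_ + X)%E]eq_bigr do rewrite lift0 splitE.
rewrite big_split/= addeA; congr (_ + _)%E.
(* The extra term [k = n.+1] vanishes because its binomial coefficient is zero; adding it makes the
   two index ranges match. *)
transitivity (\sum_(k < n.+2)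
    (1 - h)%:E * ((binomial_weight h n k)%:E * iter k (shift_mean Q) F x))%E.
  rewrite [RHS]big_ord_recr/= [X in (_ + X)%E](_ : _ = 0%E) ?adde0//.
  by rewrite /binomial_weight bin_small// !mul0r mul0e mule0.
rewrite big_ord_recl/=; congr (_ + _)%E.
by rewrite muleA -EFinM /binomial_weight !bin0 !subn0 !expr0 !mul1r !mulr1 -exprS.
Qed.

End lazy_shift_mean.

Lemma Rintegral_probability_cst {R : realType} d (T : measurableType d)
    (P : probability T R) (r : R) : \int[P]_x r = r.
Proof.
rewrite Rintegral_cst//; have -> : fine (P setT) = 1 by rewrite probability_setT.
by rewrite mulr1.
Qed.

Section integrable_EFin.
Context d (T : measurableType d) (R : realType).
Variables (mu : {measure set T -> \bar R}) (D : set T).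
Hypothesis mD : measurable D.
Implicit Types f g : T -> R.

Lemma integrableD_EFin f g : mu.-integrable D (EFin \o f) ->
  mu.-integrable D (EFin \o g) -> mu.-integrable D (EFin \o (fun x => f x + g x)).
Proof. by move=> fi gi; exact: (integrableD mD fi gi). Qed.

Lemma integrableB_EFin f g : mu.-integrable D (EFin \o f) ->
  mu.-integrable D (EFin \o g) -> mu.-integrable D (EFin \o (fun x => f x - g x)).
Proof. by move=> fi gi; exact: (integrableB mD fi gi). Qed.

Lemma integrableZl_EFin r f : mu.-integrable D (EFin \o f) ->
  mu.-integrable D (EFin \o (fun x => r * f x)).
Proof. by move=> fi; exact: (integrableZl mD r fi). Qed.

End integrable_EFin.

(** * One lazy step on exponentials of functions with bounded increments *)

Section bounded_increments.
Context {R : realType} (Q : probability nat R) (c : nat -> R).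
Hypothesis c_int : Q.-integrable setT (EFin \o c).
Implicit Types (g : nat -> R) (x j k n : nat) (h a b : R).

Definition bounded_increments g := forall x j, `|g (x + j)%N - g x| <= c j.

Let integrable_increment g x : bounded_increments g ->
  Q.-integrable setT (EFin \o (fun j => g (x + j)%N - g x)).
Proof.
move=> gc; apply: le_integrable c_int => // j _ /=; rewrite lee_fin.
by rewrite (le_trans (gc x j))// ler_norm.
Qed.

Let integrable_cst r : Q.-integrable setT (EFin \o (cst r : nat -> R)).
Proof. exact: finite_measure_integrable_cst. Qed.

Lemma integrable_bounded_increments g x : bounded_increments g ->
  Q.-integrable setT (EFin \o (fun j => g (x + j)%N)).
Proof.
move=> gc; have := integrableD measurableT (integrable_increment x gc) (integrable_cst (g x)).
by apply: eq_integrable => // j _ /=; rewrite -EFinD subrK.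
Qed.

Definition mean_shift g x : R := \int[Q]_j g (x + j)%N.

Lemma shift_mean_EFin g x : bounded_increments g ->
  shift_mean Q (EFin \o g) x = (mean_shift g x)%:E.
Proof.
move=> gc; rewrite /mean_shift /Rintegral fineK//.
exact: integrable_fin_num (integrable_bounded_increments x gc).
Qed.

Lemma mean_shiftB g x : bounded_increments g ->
  mean_shift g x - g x = \int[Q]_j (g (x + j)%N - g x).
Proof.
move=> gc; rewrite RintegralB//; [|exact: integrable_bounded_increments|exact: integrable_cst].
by rewrite Rintegral_probability_cst.
Qed.

(** The increment of the mean is the mean of increments taken at the points [x + i], and the bound
    [c j] does not depend on the base point. *)
Lemma bounded_increments_mean_shift g :
  bounded_increments g -> bounded_increments (mean_shift g).
Proof.
move=> gc x j.
have gi y := integrable_bounded_increments y gc.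
rewrite -RintegralB//.
apply: le_trans (le_normr_Rintegral _ _) _ => //.
  exact: integrableB_EFin.
apply: (@le_trans _ _ (\int[Q]_i (cst (c j) i))).
  apply: le_Rintegral => //.
  - apply: integrable_norm; exact: integrableB_EFin.
  - by move=> i _; rewrite addnAC gc.
by rewrite Rintegral_probability_cst.
Qed.

Definition lazy_mean_shift h g x : R := (1 - h) * g x + h * mean_shift g x.

Lemma bounded_increments_lazy h g : 0 <= h <= 1 ->
  bounded_increments g -> bounded_increments (lazy_mean_shift h g).
Proof.
move=> /andP[h0 h1] gc x j; have gc' := bounded_increments_mean_shift gc.
rewrite /lazy_mean_shift.
rewrite [X in `|X|](_ : _ = (1 - h) * (g (x + j)%N - g x) +
  h * (mean_shift g (x + j)%N - mean_shift g x)); last by ring.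
rewrite (le_trans (ler_normD _ _))// !normrM (ger0_norm h0) ger0_norm ?subr_ge0//.
have -> : c j = (1 - h) * c j + h * c j by ring.
by rewrite lerD// ler_wpM2l ?subr_ge0.
Qed.

Lemma iter_lazy_shift_mean_EFin h g n : 0 <= h <= 1 -> bounded_increments g ->
  bounded_increments (iter n (lazy_mean_shift h) g) /\
  iter n (lazy_shift_mean Q h) (EFin \o g) = EFin \o iter n (lazy_mean_shift h) g.
Proof.
move=> h01 gc; elim: n => //= n [IHc IHE]; split; first exact: bounded_increments_lazy.
apply/funext => x; rewrite IHE /lazy_shift_mean shift_mean_EFin//.
Qed.

Variable a : R.
Hypothesis a_ge0 : 0 <= a.
Hypothesis rem_int : Q.-integrable setT (EFin \o (fun j => expR_rem (a * c j))).

Let Psi := \int[Q]_j expR_rem (a * c j).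

(** With [expR (b + a * g x)] factored out, there remains [expR u] for [u] equal to [a] times an
    increment. It equals [1 + u + expR_rem u], whose last term is dominated by
    [expR_rem (a * c j)]. *)
Lemma shift_mean_expR g b x : bounded_increments g ->
  (shift_mean Q (fun y => (expR (b + a * g y))%:E) x <=
   (expR (b + a * g x) * (1 + a * (mean_shift g x - g x) + Psi))%:E)%E.
Proof.
move=> gc.
pose G j := 1 + a * (g (x + j)%N - g x) + expR_rem (a * c j).
have Zi : Q.-integrable setT (EFin \o (fun j => a * (g (x + j)%N - g x))).
  by apply: integrableZl_EFin => //; exact: integrable_increment.
have Gi1 : Q.-integrable setT (EFin \o (fun j => 1 + a * (g (x + j)%N - g x))).
  exact: (integrableD_EFin measurableT (integrable_cst 1) Zi).
have Gi : Q.-integrable setT (EFin \o G).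
  exact: (integrableD_EFin measurableT Gi1 rem_int).
have -> : 1 + a * (mean_shift g x - g x) + Psi = \int[Q]_j G j.
  rewrite (RintegralD measurableT Gi1 rem_int).
  rewrite (RintegralD measurableT (integrable_cst 1) Zi) mean_shiftB//.
  rewrite RintegralZl//; last exact: integrable_increment.
  by rewrite Rintegral_probability_cst.
have -> : (expR (b + a * g x) * \int[Q]_j G j)%:E =
  (\int[Q]_j (expR (b + a * g x) * G j)%:E)%E.
  under eq_integral do rewrite EFinM.
  rewrite integralZl// EFinM /Rintegral fineK//.
  exact: integrable_fin_num Gi.
apply: ge0_le_integral => //.
move=> j _; rewrite lee_fin.
  rewrite [b + a * g (x + j)%N](_ : _ = b + a * g x + a * (g (x + j)%N - g x)); last by ring.
  rewrite expRD ler_wpM2l ?expR_ge0//.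
  suff : expR_rem (a * (g (x + j)%N - g x)) <= expR_rem (a * c j).
    by rewrite /G {1}/expR_rem; lra.
  by apply: le_expR_rem; rewrite normrM ger0_norm// ler_wpM2l.
Qed.

Lemma lazy_shift_mean_expR h g b x : 0 <= h <= 1 -> bounded_increments g ->
  (lazy_shift_mean Q h (fun y => (expR (b + a * g y))%:E) x <=
   (expR (b + h * Psi + a * lazy_mean_shift h g x))%:E)%E.
Proof.
move=> /andP[h0 h1] gc; rewrite /lazy_shift_mean.
apply: le_trans (leeD (lexx _) (lee_wpmul2l _ (shift_mean_expR b x gc))) _.
  by rewrite lee_fin.
rewrite -!EFinM -EFinD lee_fin.
set E := expR (b + a * g x); set u := mean_shift g x - g x.
rewrite [leLHS](_ : _ = E * (1 + h * (a * u + Psi))); last by ring.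
rewrite [b + _ + _](_ : _ = (b + a * g x) + h * (a * u + Psi)); last first.
  by rewrite /lazy_mean_shift /u; ring.
by rewrite expRD ler_wpM2l ?expR_ge0// expR_ge1Dx.
Qed.

(** Each step adds [h * Psi] to the exponent and replaces [g] by its lazy mean, which has the same
    modulus; the parameter [b] of the one-step bound carries the constant accumulated so far. *)
Lemma iter_lazy_shift_mean_expR h g n x : 0 <= h <= 1 -> bounded_increments g ->
  (iter n (lazy_shift_mean Q h) (fun y => (expR (a * g y))%:E) x <=
   (expR (n%:R * h * Psi + a * iter n (lazy_mean_shift h) g x))%:E)%E.
Proof.
move=> h01 gc; elim: n x => [|n IH] x; first by rewrite /= !mul0r add0r.
have [gnc _] := iter_lazy_shift_mean_EFin n h01 gc.
have expR0 (y : nat) : (0 <= (expR (a * g y))%:E)%E by rewrite lee_fin expR_ge0.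
rewrite iterS.
apply: le_trans (le_lazy_shift_mean Q h01 (iter_lazy_shift_mean_ge0 Q n h01 expR0) IH x) _.
apply: le_trans (lazy_shift_mean_expR _ _ h01 gnc) _.
by rewrite lee_fin ler_expR -natr1 iterS !mulrDl mul1r.
Qed.

End bounded_increments.

Lemma Bernoulli_subr (R : realDomainType) (x : R) k : 0 <= x <= 1 ->
  1 - k%:R * x <= (1 - x) ^+ k.
Proof.
move=> /andP[x0 x1]; elim: k => [|k IH]; first by rewrite mul0r subr0 expr0.
rewrite exprS -natr1.
have : 0 <= k%:R :> R by [].
have := ler_wpM2l (_ : 0 <= 1 - x) IH; rewrite subr_ge0 => /(_ x1).
nra.
Qed.

Lemma ffact_le_expn n k : (n ^_ k <= n ^ k)%N.
Proof. by elim: k => // k IH; rewrite ffactnSr expnSr leq_mul// leq_subr. Qed.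

Lemma expn_sub_le_ffact n k j : (j <= k)%N -> ((n - k) ^ j <= n ^_ j)%N.
Proof.
elim: j => // j IH jk; rewrite ffactnSr expnSr.
apply: leq_mul; first by apply: IH; exact: ltnW.
by apply: leq_sub2l; exact: ltnW.
Qed.

(** * Comparison of binomial and Poisson weights *)

Section binomial_poisson.
Context {R : realType} (lambda : R).
Hypothesis lambda_gt0 : 0 < lambda.

(** Unlike [lambda / n%:R], this is a probability for every [n]. *)
Definition poisson_step n : R := lambda / (n%:R + lambda).

Lemma poisson_step_itv n : 0 <= poisson_step n <= 1.
Proof.
have n0 : 0 <= n%:R :> R by [].
rewrite /poisson_step divr_ge0 ?addr_ge0 ?(ltW lambda_gt0)//=.
by rewrite ler_pdivrMr ?mul1r ?lerDr// ltr_wpDl.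
Qed.

Lemma natr_poisson_step_le n : n%:R * poisson_step n <= lambda.
Proof.
have n0 : 0 <= n%:R :> R by [].
rewrite /poisson_step mulrA ler_pdivrMr ?ltr_wpDl//.
by rewrite mulrC ler_pM2l// lerDl ltW.
Qed.

(* With this step the odds [h / (1 - h)] are exactly [lambda / n]. *)
Lemma binomial_weight_poisson_step n k : (0 < n)%N -> (k <= n)%N ->
  binomial_weight (poisson_step n) n k =
  'C(n, k)%:R / n%:R ^+ k * lambda ^+ k * (1 - poisson_step n) ^+ n.
Proof.
move=> n0 kn; rewrite /binomial_weight.
have n0' : (0 < n%:R :> R) by rewrite ltr0n.
have nl0 : (n%:R + lambda) != 0 by rewrite gt_eqF// addr_gt0.
have hE : poisson_step n = (1 - poisson_step n) * (lambda / n%:R).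
  by rewrite /poisson_step; field; rewrite nl0 gt_eqF.
have -> : (1 - poisson_step n) ^+ n =
    (1 - poisson_step n) ^+ (n - k) * (1 - poisson_step n) ^+ k.
  by rewrite -exprD subnK.
rewrite [X in _ * X = _](_ : _ = ((1 - poisson_step n) * (lambda / n%:R)) ^+ k); last first.
  by rewrite -hE.
rewrite !exprMn exprVn; ring.
Qed.

(** Uses [1 - h <= expR (- h)], where [n%:R * h] falls short of [lambda] by at most
    [lambda ^+ 2 / n%:R]. The factor is uniform in [k], so the bound can be summed over all [k], and
    it tends to 1. *)
Lemma binomial_weight_le_poisson n k : (0 < n)%N ->
  binomial_weight (poisson_step n) n k <= expR (lambda ^+ 2 / n%:R) * poisson_pmf lambda k.
Proof.
move=> n0; have n0' : (0 < n%:R :> R) by rewrite ltr0n.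
have [kn|nk] := leqP k n; last first.
  by rewrite /binomial_weight bin_small// !mul0r mulr_ge0 ?expR_ge0 ?poisson_pmf_ge0.
rewrite binomial_weight_poisson_step// /poisson_pmf lambda_gt0.
have l0 := ltW lambda_gt0.
have h1 : (1 - poisson_step n) ^+ n <= expR (lambda ^+ 2 / n%:R) * expR (- lambda).
  apply: (@le_trans _ _ (expR (- poisson_step n) ^+ n)).
    rewrite lerXn2r ?nnegrE ?expR_ge0 ?expR_ge1Dx// subr_ge0.
    by have /andP[] := poisson_step_itv n.
  rewrite -expRM_natl -expRD ler_expR /poisson_step.
  rewrite -subr_ge0 [leRHS](_ : _ = lambda ^+ 3 / (n%:R * (n%:R + lambda))); last first.
    by field; rewrite !gt_eqF// addr_gt0.
  by rewrite divr_ge0 ?exprn_ge0// mulr_ge0// ?addr_ge0// ltW.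
have h2 : 'C(n, k)%:R / n%:R ^+ k <= k`!%:R^-1 :> R.
  rewrite ler_pdivrMr ?exprn_gt0// mulrC ler_pdivlMr ?ltr0n ?fact_gt0//.
  by rewrite -natrM bin_ffact -natrX ler_nat ffact_le_expn.
rewrite [leRHS](_ : _ = k`!%:R^-1 * lambda ^+ k *
  (expR (lambda ^+ 2 / n%:R) * expR (- lambda))); last by ring.
have /andP[s0 s1] := poisson_step_itv n.
apply: ler_pM => //.
- by rewrite !mulr_ge0// ?invr_ge0 ?exprn_ge0// ltW.
- by rewrite exprn_ge0// subr_ge0.
- by rewrite ler_wpM2r// exprn_ge0.
Qed.

(** Here [1 - h] is the inverse of [1 + lambda / n%:R], hence at least [expR (- (lambda / n%:R))],
    and the falling factorial is at least [(n - k) ^ k], to which Bernoulli's inequality applies.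
    The error depends on [k], so this serves for truncated sums. *)
Lemma binomial_weight_ge_poisson n k : (0 < n)%N -> (k <= n)%N ->
  poisson_pmf lambda k * (1 - k%:R ^+ 2 / n%:R) <= binomial_weight (poisson_step n) n k.
Proof.
move=> n0 kn; have n0' : (0 < n%:R :> R) by rewrite ltr0n.
rewrite binomial_weight_poisson_step// /poisson_pmf lambda_gt0.
have l0 := ltW lambda_gt0.
have h1 : expR (- lambda) <= (1 - poisson_step n) ^+ n.
  have -> : 1 - poisson_step n = (1 + lambda / n%:R)^-1.
    rewrite /poisson_step; field; rewrite !gt_eqF//= addr_gt0//.
  rewrite exprVn expRN lef_pV2 ?posrE ?expR_gt0 ?exprn_gt0//; last first.
    by rewrite addr_gt0// divr_gt0.
  rewrite [X in expR X](_ : lambda = n%:R * (lambda / n%:R)); last first.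
    by rewrite mulrC divfK// gt_eqF.
  rewrite expRM_natl lerXn2r ?nnegrE ?expR_ge0 ?expR_ge1Dx//.
  by rewrite addr_ge0// divr_ge0// ltW.
have h2 : k`!%:R^-1 * (1 - k%:R ^+ 2 / n%:R) <= 'C(n, k)%:R / n%:R ^+ k :> R.
  rewrite ler_pdivlMr ?exprn_gt0// -mulrA mulrC ler_pdivrMr ?ltr0n ?fact_gt0//.
  rewrite -natrM bin_ffact.
  have kn1 : 0 <= (k%:R / n%:R : R) <= 1.
    by rewrite divr_ge0//= ler_pdivrMr// mul1r ler_nat.
  have B := @Bernoulli_subr _ _ k kn1; rewrite mulrA -expr2 in B.
  have nk0 : 0 <= n%:R ^+ k :> R by rewrite exprn_ge0.
  apply: le_trans (ler_wpM2r nk0 B) _.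
  rewrite -exprMn mulrBl mul1r divfK ?gt_eqF// -natrB// -natrX ler_nat.
  exact: expn_sub_le_ffact.
rewrite [leLHS](_ : _ = k`!%:R^-1 * (1 - k%:R ^+ 2 / n%:R) *
  (lambda ^+ k * expR (- lambda))); last by ring.
rewrite -[leRHS]mulrA.
apply: (@le_trans _ _ ('C(n, k)%:R / n%:R ^+ k * (lambda ^+ k * expR (- lambda)))).
  by rewrite ler_wpM2r// mulr_ge0 ?expR_ge0// exprn_ge0.
by rewrite !ler_wpM2l// ?exprn_ge0// divr_ge0// exprn_ge0// ltW.
Qed.

End binomial_poisson.

Lemma nneseries_le_bound (R : realType) (u : nat -> \bar R) (b : \bar R) :
  (forall k, 0 <= u k)%E -> (forall M, \sum_(k < M) u k <= b)%E ->
  (\sum_(k <oo) u k <= b)%E.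
Proof.
move=> u0 ub; apply: lime_le; first exact: is_cvg_nneseries.
by apply: nearW => M; rewrite big_mkord.
Qed.

(** * Passage to the Poisson limit *)

Section compound_poisson_mgf.
Context {R : realType} (lambda : R) (Q : probability nat R).
Context (mu : {measure set nat -> \bar R}).
Hypothesis lambda_gt0 : 0 < lambda.
Hypothesis mu_CP : is_compound_poisson lambda Q mu.

(** The Poisson series of the exponential is truncated at [M]. For fixed [M], the lower weight bound
    compares it with [n] lazy steps, and the upper weight bound controls the resulting mean of [g]
    by [m]; then [n] tends to infinity. *)
Lemma compound_poisson_mgf (c g : nat -> R) (a m : R) :
  Q.-integrable setT (EFin \o c) ->
  0 <= a -> Q.-integrable setT (EFin \o (fun j => expR_rem (a * c j))) ->
  bounded_increments c g -> (forall x, 0 <= g x) ->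
  (\int[mu]_x (g x)%:E <= m%:E)%E ->
  (\int[mu]_x (expR (a * g x))%:E <=
   (expR (lambda * (\int[Q]_j expR_rem (a * c j))%R + a * m))%:E)%E.
Proof.
move=> c_int a0 rem_int gc g0.
rewrite !(ge0_integral_compound_poisson lambda_gt0 mu_CP)//.
set Psi := \int[Q]_j _ => gm.
set F := EFin \o (fun x => expR (a * g x)).
have F0 x : (0 <= F x)%E by rewrite lee_fin expR_ge0.
have p0 k : 0 <= poisson_pmf lambda k by exact: poisson_pmf_ge0.
have TF0 k x : (0 <= iter k (shift_mean Q) F x)%E by exact: iter_shift_mean_ge0.
have Tg0 k x : (0 <= iter k (shift_mean Q) (EFin \o g) x)%E.
  by apply: iter_shift_mean_ge0 => y; rewrite lee_fin.
have Psi0 : 0 <= Psi by apply: Rintegral_ge0 => j _; exact: expR_rem_ge0.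
apply: nneseries_le_bound => [k|M]; first by rewrite mule_ge0// lee_fin.
set S := (\sum_(k < M) _)%E.
have S0 : (0 <= S)%E by apply: sume_ge0 => k _; rewrite mule_ge0// lee_fin.
have step n : (0 < n)%N -> (M ^ 2 <= n)%N ->
  ((1 - M%:R ^+ 2 / n%:R)%:E * S <=
   (expR (lambda * Psi + a * (expR (lambda ^+ 2 / n%:R) * m)))%:E)%E.
  move=> n0 Mn.
  have n0' : (0 < n%:R :> R) by rewrite ltr0n.
  have h01 := poisson_step_itv lambda_gt0 n.
  have Mn' : (M <= n.+1)%N.
    by apply: leq_trans (leqW Mn); case: (M) => // M'; rewrite -mulnn leq_pmulr.
  have b0 k : (0 <= (binomial_weight (poisson_step lambda n) n k)%:E)%E.
    by rewrite lee_fin binomial_weight_ge0.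
  have mean_le : iter n (lazy_mean_shift Q (poisson_step lambda n)) g 0%N <=
      expR (lambda ^+ 2 / n%:R) * m.
    rewrite -lee_fin.
    have [_ /(congr1 (@^~ 0%N)) /= <-] := iter_lazy_shift_mean_EFin c_int n h01 gc.
    rewrite iter_lazy_shift_mean//.
    apply: (@le_trans _ _ (\sum_(k < n.+1) (expR (lambda ^+ 2 / n%:R))%:E *
        ((poisson_pmf lambda k)%:E * iter k (shift_mean Q) (EFin \o g) 0%N))%E).
      apply: lee_sum => k _; rewrite muleA -EFinM lee_wpmul2r// lee_fin.
      exact: binomial_weight_le_poisson.
    rewrite -ge0_sume_distrr; last by move=> k _; rewrite mule_ge0// lee_fin.
    rewrite EFinM lee_wpmul2l ?lee_fin ?expR_ge0//; apply: le_trans gm.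
    rewrite -(big_mkord xpredT (fun k => (poisson_pmf lambda k)%:E *
        iter k (shift_mean Q) (EFin \o g) 0%N)%E).
    by apply: nneseries_lim_ge => k _; rewrite mule_ge0// lee_fin.
  apply: (@le_trans _ _ (iter n (lazy_shift_mean Q (poisson_step lambda n)) F 0%N)).
    rewrite iter_lazy_shift_mean// /S ge0_sume_distrr; last first.
      by move=> k _; rewrite mule_ge0// lee_fin.
    rewrite (big_ord_widen n.+1 (fun k => (1 - M%:R ^+ 2 / n%:R)%:E *
      ((poisson_pmf lambda k)%:E * iter k (shift_mean Q) F 0%N))%E)//.
    rewrite big_mkcond/=; apply: lee_sum => k _; case: ifPn => kM; last by rewrite mule_ge0.
    rewrite muleA -EFinM lee_wpmul2r// lee_fin mulrC.
    have kn : (k <= n)%N by rewrite -ltnS.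
    apply: le_trans (binomial_weight_ge_poisson lambda_gt0 n0 kn).
    rewrite ler_wpM2l// lerB// ler_wpM2r ?invr_ge0 ?ler0n//.
    by rewrite lerXn2r ?nnegrE ?ler0n// ler_nat ltnW.
  apply: le_trans (iter_lazy_shift_mean_expR c_int a0 rem_int n 0 h01 gc) _.
  rewrite lee_fin ler_expR lerD// ?ler_wpM2l//.
  by rewrite ler_wpM2r// natr_poisson_step_le.
(* Taking [n] to be [(M ^ 2).+1] makes the factor [1 - M%:R ^+ 2 / n%:R] positive, so an infinite
   [S] would contradict the finite bound. *)
have Sfin : S \is a fin_num.
  rewrite ge0_fin_numE// ltNge leye_eq; apply/negP => /eqP Sy.
  have := step (M ^ 2).+1 isT (leqnSn _).
  rewrite Sy gt0_muley ?leye_eq//.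
  by rewrite lte_fin subr_gt0 ltr_pdivrMr// mul1r -natrX ltr_nat.
rewrite -(fineK Sfin) lee_fin.
(* The gap in [step], as a function of the reciprocal of [n]. Since [harmonic n] is the inverse of
   [n.+1], it is evaluated along [step n.+1], and continuity gives the limit [G 0]. *)
pose G u := expR (lambda * Psi + a * (expR (lambda ^+ 2 * u) * m)) -
  (1 - M%:R ^+ 2 * u) * fine S.
have Gc : G (@harmonic R n) @[n --> \oo] --> G 0.
  apply: (@continuous_cvg _ R R _ _ _ G); last exact: cvg_harmonic.
  rewrite /G; apply: cvgB.
    apply: continuous_cvg; first exact: continuous_expR.
    apply: cvgD; first exact: cvg_cst.
    apply: cvgM; first exact: cvg_cst.
    apply: cvgM; last exact: cvg_cst.
    apply: continuous_cvg; first exact: continuous_expR.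
    by apply: cvgM; [exact: cvg_cst|].
  apply: cvgM; last exact: cvg_cst.
  apply: cvgB; first exact: cvg_cst.
  by apply: cvgM; [exact: cvg_cst|].
have : 0 <= G 0.
  apply: (cvgr_to_ge Gc); near=> n.
  rewrite /G subr_ge0 -lee_fin EFinM fineK//.
  by apply: (step n.+1) => //; near: n; exists (M ^ 2)%N => // n /= Mn; exact: leqW.
by rewrite /G !mulr0 expR0 mul1r subr0 mul1r subr_ge0.
Unshelve. all: by end_near.
Qed.

End compound_poisson_mgf.

(** * The rate function and its Legendre transform *)

Lemma quadratic_remainder_is_derive (R : realType) (I : R -> R) (a l K e : R) :
  0 < e ->
  (forall h, `|h| <= e -> `|I (a + h) - I a - h * l| <= h ^+ 2 * K) ->
  is_derive a 1 I l.
Proof.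
move=> e0 IK.
have K0 : 0 <= K.
  have e2 : 0 < e ^+ 2 by exact: exprn_gt0.
  have := IK e; rewrite gtr0_norm// => /(_ (lexx _)) /(le_trans (normr_ge0 _)).
  by rewrite (pmulr_rge0 _ e2).
have cvgI : h^-1 *: (I (h *: 1 + a) - I a) @[h --> 0^'] --> l.
  apply/cvgrPdist_le => d d0; near=> h.
  have h0 : h != 0 by near: h; exact: nbhs_dnbhs_neq.
  have he : `|h| <= e by near: h; apply: dnbhs0_le.
  (* Adding 1 keeps the denominator positive when [K] is zero. *)
  have hd : `|h| <= d / (K + 1) by near: h; apply: dnbhs0_le; rewrite divr_gt0// ltr_wpDl.
  rewrite {1}/GRing.scale/= {1}/GRing.scale/= mulr1 (addrC h).
  rewrite [l - _](_ : _ = - (h^-1 * (I (a + h) - I a - h * l))); last by field.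
  rewrite normrN normrM normfV ler_pdivrMl ?normr_gt0//.
  apply: le_trans (IK _ he) _.
  rewrite -normr_id -[h ^+ 2]ger0_norm ?sqr_ge0// normrX normr_id expr2 -mulrA ler_wpM2l//.
  rewrite -(ler_pM2r (_ : 0 < K + 1)) ?divfK in hd; last 2 first.
  - by rewrite gt_eqF// ltr_wpDl.
  - by rewrite ltr_wpDl.
  by apply: le_trans hd; rewrite ler_wpM2l// lerDl.
apply: DeriveDef; first by apply/cvg_ex; exists l.
exact: cvg_lim cvgI.
Unshelve. all: by end_near.
Qed.

Section rate_function.
Context {R : realType} (Q : probability nat R) (lambda : R) (c : nat -> R) (L : \bar R).
Hypothesis lambda_ge0 : 0 <= lambda.
Hypothesis c_ge0 : forall j, 0 <= c j.
Hypothesis exp_int : forall a, (a%:E < L)%E ->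
  Q.-integrable setT (EFin \o (fun j => expR (a * c j))).
Implicit Types a b h e : R.

(** This is [Ieps] for an abstract log-modulus [c], written as an integral; [rate_slope] is the
    derivative taken under the integral sign. *)
Definition rate a : R := lambda * \int[Q]_j expR_rem (a * c j).
Definition rate_slope a : R := lambda * \int[Q]_j ((expR (a * c j) - 1) * c j).

Lemma ex_lt_ereal a : (a%:E < L)%E -> exists2 e, 0 < e & ((a + e)%:E < L)%E.
Proof.
case: L => [l|_|//]; last by exists 1 => //; rewrite ltry.
by rewrite lte_fin => al; exists ((l - a) / 2); rewrite ?lte_fin; lra.
Qed.

(** The room [e] between [a] and [L] absorbs the square: [y <= expR y] at [y = e * c j / 2],
    squared, gives the constant [4 / e ^+ 2]. *)
Lemma integrable_sqr_exp a : (a%:E < L)%E ->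
  Q.-integrable setT (EFin \o (fun j => c j ^+ 2 * expR (a * c j))).
Proof.
move=> /ex_lt_ereal[e e0 aeL].
apply: le_integrable (integrableZl_EFin measurableT (4 / e ^+ 2) (exp_int aeL)) => // j _ /=.
rewrite lee_fin !ger0_norm ?mulr_ge0 ?expR_ge0 ?invr_ge0 ?sqr_ge0//.
have -> : (a + e) * c j = a * c j + e * c j by ring.
rewrite expRD mulrCA [leLHS]mulrC ler_wpM2l ?expR_ge0//.
have : (e * c j / 2) ^+ 2 <= expR (e * c j).
  have -> : e * c j = 2%:R * (e * c j / 2) by field.
  rewrite expRM_natl [X in X / 2](_ : _ = e * c j); last by field.
  have x0 : 0 <= e * c j / 2 by rewrite divr_ge0// mulr_ge0// ltW.
  rewrite lerXn2r ?nnegrE ?expR_ge0//.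
  by apply: le_trans (expR_ge1Dx _); rewrite lerDr.
rewrite -ler_pdivrMl ?divr_gt0 ?exprn_gt0//; apply: le_trans.
by rewrite le_eqVlt; apply/orP; left; apply/eqP; field; rewrite gt_eqF.
Qed.

Lemma integrable_mul_exp a : (a%:E < L)%E ->
  Q.-integrable setT (EFin \o (fun j => c j * expR (a * c j))).
Proof.
move=> aL.
have sum_int := integrableD_EFin measurableT (exp_int aL) (integrable_sqr_exp aL).
apply: le_integrable sum_int => // j _ /=.
rewrite lee_fin !ger0_norm ?addr_ge0 ?mulr_ge0 ?expR_ge0 ?sqr_ge0//.
rewrite -{2}[expR _]mul1r -mulrDl ler_wpM2r ?expR_ge0//.
by have := sqr_ge0 (c j - 1); have := c_ge0 j; nra.
Qed.

Hypothesis L_gt0 : (0 < L)%E.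

Lemma integrable_modulus : Q.-integrable setT (EFin \o c).
Proof.
have := integrable_mul_exp L_gt0; apply: eq_integrable => // j _ /=.
by rewrite mul0r expR0 mulr1.
Qed.

Let integrable1 : Q.-integrable setT (EFin \o (cst 1 : nat -> R)).
Proof. exact: finite_measure_integrable_cst. Qed.

Lemma integrable_rem a : (a%:E < L)%E ->
  Q.-integrable setT (EFin \o (fun j => expR_rem (a * c j))).
Proof.
move=> aL; apply: integrableB_EFin => //; last exact: integrableZl_EFin integrable_modulus.
by apply: integrableB_EFin => //; exact: exp_int.
Qed.

Lemma integrable_slope a : (a%:E < L)%E ->
  Q.-integrable setT (EFin \o (fun j => (expR (a * c j) - 1) * c j)).
Proof.
move=> aL; have := integrableB_EFin measurableT (integrable_mul_exp aL) integrable_modulus.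
by apply: eq_integrable => // j _ /=; congr EFin; ring.
Qed.

Lemma rate_ge0 a : 0 <= rate a.
Proof. by rewrite mulr_ge0//; apply: Rintegral_ge0 => j _; exact: expR_rem_ge0. Qed.

Lemma rate0 : rate 0 = 0.
Proof.
rewrite /rate (eq_Rintegral Q (g := cst 0)) ?Rintegral_probability_cst ?mulr0// => j _.
by rewrite /expR_rem mul0r expR0 subrr subr0.
Qed.

Lemma rate_slope0 : rate_slope 0 = 0.
Proof.
rewrite /rate_slope (eq_Rintegral Q (g := cst 0)) ?Rintegral_probability_cst ?mulr0// => j _.
by rewrite mul0r expR0 subrr mul0r.
Qed.

(** The first-order remainder is itself an integral of a nonnegative function. Its sign gives
    convexity, its size differentiability. *)
Lemma rate_remE a h : (a%:E < L)%E -> ((a + h)%:E < L)%E ->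
  Q.-integrable setT (EFin \o (fun j => expR (a * c j) * expR_rem (h * c j))) /\
  rate (a + h) - rate a - h * rate_slope a =
  lambda * \int[Q]_j (expR (a * c j) * expR_rem (h * c j)).
Proof.
move=> aL ahL; have i1 := integrable_rem ahL; have i2 := integrable_rem aL.
have i3 := integrableZl_EFin measurableT h (integrable_slope aL).
have i12 := integrableB_EFin measurableT i1 i2.
have E j : expR (a * c j) * expR_rem (h * c j) =
    expR_rem ((a + h) * c j) - expR_rem (a * c j) - h * ((expR (a * c j) - 1) * c j).
  by rewrite /expR_rem mulrDl expRD; ring.
split.
  have := integrableB_EFin measurableT i12 i3.
  by apply: eq_integrable => // j _ /=; rewrite E.
under eq_Rintegral do rewrite E.
rewrite RintegralB// RintegralB// RintegralZl//; last exact: integrable_slope.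
by rewrite /rate /rate_slope; ring.
Qed.

Lemma rate_tangent a b : (a%:E < L)%E -> (b%:E < L)%E ->
  rate_slope a * (b - a) <= rate b - rate a.
Proof.
move=> aL bL; have bE : b = a + (b - a) by ring.
have abL : ((a + (b - a))%:E < L)%E by rewrite -bE.
have [_] := rate_remE aL abL; rewrite -bE.
have : 0 <= lambda * \int[Q]_j (expR (a * c j) * expR_rem ((b - a) * c j)).
  by rewrite mulr_ge0//; apply: Rintegral_ge0 => j _; rewrite mulr_ge0 ?expR_ge0 ?expR_rem_ge0.
lra.
Qed.

(** By [expR_rem_le_sqr] the integrand of the remainder is at most [h ^+ 2] times
    [c j ^+ 2 * expR ((a + e) * c j)], uniformly for [h] up to [e] in absolute value. *)
Lemma rate_quadratic_remainder a : (a%:E < L)%E ->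
  exists e k, [/\ 0 < e, ((a + e)%:E < L)%E & forall h, `|h| <= e ->
    `|rate (a + h) - rate a - h * rate_slope a| <= h ^+ 2 * k].
Proof.
move=> aL; have [e e0 aeL] := ex_lt_ereal aL.
exists e, (lambda * \int[Q]_j (c j ^+ 2 * expR ((a + e) * c j))); split => // h he.
have ahL : ((a + h)%:E < L)%E.
  by apply: le_lt_trans aeL; rewrite lee_fin lerD2l (le_trans (ler_norm _)).
have [ri ->] := rate_remE aL ahL.
rewrite ger0_norm; last first.
  by rewrite mulr_ge0//; apply: Rintegral_ge0 => j _; rewrite mulr_ge0 ?expR_ge0 ?expR_rem_ge0.
rewrite mulrCA ler_wpM2l// -RintegralZl//; last exact: integrable_sqr_exp.
apply: le_Rintegral => //.
  by apply: integrableZl_EFin => //; exact: integrable_sqr_exp.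
move=> j _; apply: (@le_trans _ _ (expR (a * c j) * ((h * c j) ^+ 2 * expR `|h * c j|))).
  by rewrite ler_wpM2l ?expR_ge0 ?expR_rem_le_sqr.
rewrite mulrCA exprMn -mulrA ler_wpM2l ?sqr_ge0// ler_wpM2l ?sqr_ge0// -expRD ler_expR.
by rewrite normrM (ger0_norm (c_ge0 j)) mulrDl lerD2l ler_wpM2r.
Qed.

Lemma rate_is_derive a : (a%:E < L)%E -> is_derive a 1 rate (rate_slope a).
Proof.
move=> /rate_quadratic_remainder[e [k [e0 _ ek]]].
exact: quadratic_remainder_is_derive e0 ek.
Qed.

(** Both [rate] and its slope vanish at 0, so [rate a] is at most [a ^+ 2 * k] near 0; the second
    entry of the minimum makes [a * k <= s]. *)
Lemma rate_small s : 0 < s ->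
  exists a, [/\ 0 < a, (a%:E < L)%E & rate a <= a * s].
Proof.
move=> s0; have [e [k [e0 eL ek]]] := rate_quadratic_remainder L_gt0.
pose a := Num.min e (s / (`|k| + 1)).
have k1 : 0 < `|k| + 1 by rewrite ltr_wpDl.
have a0 : 0 < a by rewrite lt_min e0 divr_gt0.
have ae : a <= e by rewrite ge_min lexx.
exists a; split => //.
  by apply: le_lt_trans eL; rewrite add0r lee_fin.
have := ek a; rewrite gtr0_norm// => /(_ ae).
rewrite add0r rate0 rate_slope0 mulr0 !subr0 ger0_norm ?rate_ge0// => /le_trans; apply.
rewrite expr2 -mulrA ler_pM2l//.
apply: (@le_trans _ _ (a * (`|k| + 1))).
  by rewrite ler_pM2l// (le_trans (ler_norm _))// lerDl.
by rewrite -ler_pdivlMr// ge_min lexx orbT.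
Qed.

(** The integrands are ordered pointwise, and the atom at [j] alone contributes a strictly positive
    difference. *)
Lemma rate_slope_lt a b j : 0 < lambda -> (0 < Q [set j])%E -> 0 < c j ->
  a < b -> (b%:E < L)%E -> rate_slope a < rate_slope b.
Proof.
move=> l0 Qj cj ab bL; have aL : (a%:E < L)%E by apply: lt_trans bL; rewrite lte_fin.
rewrite /rate_slope ltr_pM2l// -subr_gt0 -RintegralB//; [|exact: integrable_slope..].
pose D k := (expR (b * c k) - 1) * c k - (expR (a * c k) - 1) * c k.
have Di : Q.-integrable setT (EFin \o D).
  by apply: integrableB_EFin => //; exact: integrable_slope.
have D0 k : 0 <= D k.
  rewrite /D -mulrBl mulr_ge0// subr_ge0 lerB// ler_expR ler_wpM2r// ltW//.
rewrite -lte_fin [X in (_ < X)%E](_ : _ = \int[Q]_k (D k)%:E)%E; last first.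
  by rewrite /Rintegral fineK//; exact: integrable_fin_num Di.
rewrite ge0_integral_nat; last by move=> k; rewrite lee_fin.
rewrite (nneseriesD1 (n := j))//; last by move=> k _; rewrite mule_ge0// lee_fin.
apply: (@lt_le_trans _ _ ((D j)%:E * Q [set j])%E); last first.
  by rewrite leeDl// nneseries_ge0// => k _ _; rewrite mule_ge0// lee_fin.
rewrite mule_gt0// lte_fin /D -mulrBl mulr_gt0// subr_gt0 ltrD2r.
by rewrite ltr_expR ltr_pM2r.
Qed.

End rate_function.

(** * Legendre transform and integral of the inverse slope *)

Section legendre_duality.
Context {R : realType} (I i : R -> R) (L : \bar R).
Implicit Types a b s x : R.

Hypothesis tangent : forall a b, (a%:E < L)%E -> (b%:E < L)%E ->
  i a * (b - a) <= I b - I a.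
Hypothesis I_small : forall s, 0 < s ->
  exists a, [/\ 0 < a, (a%:E < L)%E & I a <= a * s].
Hypothesis L_gt0 : (0 < L)%E.
Hypothesis i0 : i 0 = 0.

Definition slope_inv s : \bar R := ereal_sup [set a%:E | a in [set a |
  [/\ 0 <= a, (a%:E < L)%E & i a <= s]]].

(** At [s = ln (t / T)] this is minus the infimum in the exponent of the polynomial bound. *)
Definition legendre s : \bar R := ereal_sup [set (a * s - I a)%:E | a in [set a |
  0 < a /\ (a%:E < L)%E]].

Lemma slope_inv_ge0 s : 0 <= s -> (0 <= slope_inv s)%E.
Proof. by move=> s0; apply: ereal_sup_ubound; exists 0 => //; split => //; rewrite i0. Qed.

Lemma le_slope_inv s x : s <= x -> (slope_inv s <= slope_inv x)%E.
Proof.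
move=> sx; apply: le_ereal_sup => _ [a [a0 aL ia] <-]; exists a => //; split => //.
exact: le_trans sx.
Qed.

(** By monotonicity, preimages of upper rays are intervals. *)
Lemma measurable_slope_inv (D : set R) : measurable D -> measurable_fun D slope_inv.
Proof.
move=> mD.
apply: (measurability (@ErealGenCInfty.G R)) => [|/= _ [_] [r] -> <-].
  exact: ErealGenCInfty.measurableE.
apply: measurableI => //; apply: is_interval_measurable => s t/=.
rewrite !in_itv/= !andbT => fs ft u /andP[su ut].
by rewrite in_itv/= andbT (le_trans fs)// le_slope_inv.
Qed.

Lemma legendre_ge0 s : 0 < s -> (0 <= legendre s)%E.
Proof.
move=> /I_small[a [a0 aL Ia]]; apply: (@le_trans _ _ (a * s - I a)%:E).
  by rewrite lee_fin subr_ge0.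
by apply: ereal_sup_ubound; exists a.
Qed.

Lemma legendre_increment s e : 0 <= s -> 0 < e ->
  (e%:E * slope_inv s + legendre s <= legendre (s + e))%E.
Proof.
move=> s0 e0.
have [->|Mfin] := eqVneq (legendre (s + e)) +oo%E; first by rewrite leey.
(* The larger of [a] and [b] is the competitor at [s + e]. If it is [b], then [e * b] covers
   [e * a]; if it is [a], the tangent at [a], of slope at most [s], shows that [a * s - I a] is at
   least [b * s - I b]. *)
have key a b : 0 <= a -> (a%:E < L)%E -> i a <= s -> 0 < b -> (b%:E < L)%E ->
    ((e * a + (b * s - I b))%R%:E <= legendre (s + e))%E.
  move=> a0 aL ia b0 bL; have [ab|ba] := leP a b.
    apply: (@le_trans _ _ (b * (s + e) - I b)%:E).
      by rewrite lee_fin; have := ler_wpM2l (ltW e0) ab; lra.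
    by apply: ereal_sup_ubound; exists b.
  apply: (@le_trans _ _ (a * (s + e) - I a)%:E).
    rewrite lee_fin; have := tangent aL bL.
    have : i a * (a - b) <= s * (a - b) by rewrite ler_wpM2r// subr_ge0 ltW.
    by lra.
  by apply: ereal_sup_ubound; exists a => //; split => //; exact: lt_trans ba.
have key' a : 0 <= a -> (a%:E < L)%E -> i a <= s ->
    ((e * a)%:E + legendre s <= legendre (s + e))%E.
  move=> a0 aL ia; rewrite addeC -leeBrDr//; apply: ge_ereal_sup => _ [b [b0 bL] <-].
  by rewrite leeBrDr// -EFinD addrC key.
have [a1 [a10 a1L _]] := @I_small 1 ltr01.
(* Finiteness of both transforms lets them be moved across inequalities, so that the supremum over
   [a] can be taken. *)
have M1 : legendre (s + e) \is a fin_num.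
  rewrite fin_numE Mfin andbT gt_eqF//; apply: lt_le_trans (key 0 a1 _ _ _ _ _) => //.
  - by rewrite ltNyr.
  - by rewrite i0.
have G1 : legendre s \is a fin_num.
  rewrite fin_numE; apply/andP; split.
    rewrite gt_eqF//; apply: (@lt_le_trans _ _ (a1 * s - I a1)%:E); first by rewrite ltNyr.
    by apply: ereal_sup_ubound; exists a1.
  rewrite lt_eqF//; apply: (@le_lt_trans _ _ (legendre (s + e))); last by rewrite ltey_eq M1.
  by have := @key' 0; rewrite mulr0 add0e i0; apply.
rewrite -leeBrDr// -lee_pdivlMl//; apply: ge_ereal_sup => _ [a [a0 aL ia] <-].
by rewrite lee_pdivlMl// leeBrDr// -EFinM key'.
Qed.

(** Upper Riemann sum: on each cell [slope_inv] is bounded by its value at the right end, and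
    [legendre_increment] from there reaches one cell further. Hence [n] on the left and [n.+1] on
    the right. *)
Lemma integral_slope_inv_step x n : 0 < x ->
  (\int[lebesgue_measure]_(s in `[0%R, (n%:R * x)%R]) slope_inv s <= legendre (n.+1%:R * x))%E.
Proof.
move=> x0; elim: n => [|n IH].
  by rewrite mul0r set_itv1 integral_set1 mul1r legendre_ge0.
have n0 : 0 <= n%:R * x by rewrite mulr_ge0// ltW.
have nx : n%:R * x <= n.+1%:R * x by rewrite ler_wpM2r ?ler_nat// ltW.
have J0 s : `[0, n.+1%:R * x]%classic s -> (0 <= slope_inv s)%E.
  by rewrite /= in_itv/= => /andP[s0 _]; exact: slope_inv_ge0.
have UE : `[0, n.+1%:R * x]%classic = `[0, n%:R * x] `|` `]n%:R * x, n.+1%:R * x].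
  by rewrite -itv_bndbnd_setU// bnd_simp.
rewrite UE in J0 *; rewrite ge0_integral_setU//=; last 2 first.
- by apply: measurable_slope_inv; exact: measurableU.
- apply/disj_setPS => s [] /=; rewrite !in_itv/= => /andP[_ sn] /andP[ns _].
  by have := lt_le_trans ns sn; rewrite ltxx.
have B : (\int[lebesgue_measure]_(s in `](n%:R * x)%R, (n.+1%:R * x)%R]) slope_inv s <=
    x%:E * slope_inv (n.+1%:R * x))%E.
  apply: (@le_trans _ _ (\int[lebesgue_measure]_(s in `](n%:R * x)%R, (n.+1%:R * x)%R])
     cst (slope_inv (n.+1%:R * x)) s)%E).
    apply: ge0_le_integral => //.
    - by move=> s sI; apply: J0; right.
    - exact: measurable_slope_inv.
    - by move=> s; rewrite /= in_itv/= => /andP[_ sx]; exact: le_slope_inv.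
  rewrite integral_cst//= lebesgue_measure_itv/= lte_fin.
  rewrite ltr_pM2r// ltr_nat ltnSn -EFinB -mulrBl -natr1 [n%:R + 1]addrC addrK mul1r.
  by rewrite muleC.
apply: (le_trans (leeD IH B)); rewrite addeC.
rewrite -[in X in (_ <= X)%E]natr1 mulrDl mul1r.
by apply: legendre_increment; rewrite // mulr_ge0// ltW.
Qed.

(** With mesh [x / n.+1%:R], the extra cell on the right ends exactly at [x]. The domains on the
    left increase to [[0, x[], and monotone convergence concludes. *)
Lemma integral_slope_inv_le x : 0 < x ->
  (\int[lebesgue_measure]_(s in `[0%R, x]) slope_inv s <= legendre x)%E.
Proof.
move=> x0; rewrite -integral_itv_bndo_bndc; last exact: measurable_slope_inv.
pose F n := `[0, n%:R * (x / n.+1%:R)]%classic.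
have n1 n : 0 < n.+1%:R :> R by [].
have FE : `[0, x[%classic = \bigcup_n F n.
  apply/seteqP; split => s /=.
    rewrite in_itv/= => /andP[s0 sx].
    (* This inequality is a rearrangement of [s <= n%:R * (x / n.+1%:R)]. *)
    have [n sn] : exists n, x / (x - s) <= n.+1%:R.
      by exists (Num.truncn (x / (x - s))); exact/ltW/truncnS_gt.
    exists n => //; rewrite /F/= in_itv/= s0/=.
    rewrite mulrA ler_pdivlMr// -natr1.
    move: sn; rewrite ler_pdivrMr ?subr_gt0// -natr1; lra.
  move=> [n _]; rewrite /F/= !in_itv/= => /andP[-> /le_lt_trans]; apply.
  by rewrite mulrA ltr_pdivrMr// mulrC ltr_pM2l// ltr_nat.
have mJ n := measurable_slope_inv (measurable_itv `[0, n%:R * (x / n.+1%:R)]).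
have Fc : (\int[lebesgue_measure]_(s in F n) slope_inv s)%E @[n --> \oo] -->
    (\int[lebesgue_measure]_(s in `[0%R, x[) slope_inv s)%E.
  rewrite FE; apply: ge0_nondecreasing_set_cvg_integral => //.
  - move=> m n mn; rewrite subsetEset => s; rewrite /F/= !in_itv/= => /andP[-> /le_trans].
    apply; rewrite mulrCA [leRHS]mulrCA ler_pM2l// ler_pdivrMr// mulrAC ler_pdivlMr//.
    by rewrite -!natrM ler_nat !mulnS leq_add// mulnC.
  - by move=> n; exact: measurable_itv.
  - by move=> n s; rewrite /F/= in_itv/= => /andP[s0 _]; exact: slope_inv_ge0.
rewrite -(cvg_lim _ Fc)//; apply: lime_le; first by apply/cvg_ex; eexists; exact: Fc.
apply: nearW => n.
have := @integral_slope_inv_step (x / n.+1%:R) n; rewrite divr_gt0// => /(_ isT).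
by rewrite [n.+1%:R * _]mulrC divfK// gt_eqF.
Qed.

End legendre_duality.

(** * Deviations of Lipschitz functions *)

Section poisson_mean.
Context {R : realType} (lambda : R) (Q : probability nat R) (mu : probability nat R).
Hypothesis lambda_gt0 : 0 < lambda.
Hypothesis mu_CP : is_compound_poisson lambda Q mu.

Lemma sum_poisson_pmf_le1 n : \sum_(k < n) poisson_pmf lambda k <= 1.
Proof.
have p0 k : 0 <= poisson_pmf lambda k by exact: poisson_pmf_ge0.
have p1 : (\sum_(k <oo) (poisson_pmf lambda k)%:E = 1)%E.
  rewrite nneseries_esumT; last by move=> *; rewrite lee_fin.
  have : poisson_prob lambda 0 setT = 1%E by exact: probability_setT.
  by rewrite /poisson_prob lambda_gt0.
rewrite -lee_fin -[leRHS]/1%E -p1.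
rewrite -sumEFin -(big_mkord xpredT (fun k => (poisson_pmf lambda k)%:E)).
by apply: nneseries_lim_ge => k _; rewrite lee_fin.
Qed.

Lemma poisson_pmfS k : k.+1%:R * poisson_pmf lambda k.+1 = lambda * poisson_pmf lambda k.
Proof.
rewrite /poisson_pmf lambda_gt0 factS natrM exprS; field.
by rewrite pnatr_eq0 -lt0n fact_gt0 /=.
Qed.

Lemma sum_poisson_pmf_mean_le n : \sum_(k < n) k%:R * poisson_pmf lambda k <= lambda.
Proof.
case: n => [|n]; first by rewrite big_ord0 ltW.
rewrite big_ord_recl mul0r add0r.
under eq_bigr do rewrite lift0 poisson_pmfS.
by rewrite -mulr_sumr ler_piMr ?sum_poisson_pmf_le1// ltW.
Qed.

(** After [k] jumps the mean position has moved by [k%:R * q], and the Poisson mean of [k] is at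
    most [lambda]. *)
Lemma compound_poisson_mean_le (q : R) :
  (\int[Q]_j (j%:R)%:E = q%:E)%E ->
  (\int[mu]_z (z%:R)%:E <= (lambda * q)%:E)%E.
Proof.
move=> qE.
have q0 : 0 <= q by rewrite -lee_fin -qE; apply: integral_ge0 => j _; rewrite lee_fin.
have TE k x : iter k (shift_mean Q) (EFin \o (fun j => j%:R)) x = (x%:R + k%:R * q)%:E.
  elim: k x => [|k IH] x; first by rewrite /= mul0r addr0.
  rewrite iterS (funext IH) /shift_mean.
  rewrite (eq_integral (fun j => ((x%:R + k%:R * q)%:E + (j%:R)%:E)%E)); last first.
    by move=> j _; rewrite -EFinD natrD; congr EFin; ring.
  rewrite ge0_integralD//; last by move=> *; rewrite lee_fin addr_ge0// mulr_ge0.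
  rewrite qE [X in (X + _)%E](_ : _ = (x%:R + k%:R * q)%:E); last first.
    by rewrite integral_cst// -[X in (_ * X)%E]/(Q setT) probability_setT mule1.
  by rewrite -EFinD -natr1; congr EFin; ring.
rewrite (ge0_integral_compound_poisson lambda_gt0 mu_CP)//.
apply: nneseries_le_bound => [k|M].
  by rewrite TE -EFinM lee_fin mulr_ge0 ?poisson_pmf_ge0// addr_ge0// mulr_ge0.
under eq_bigr do rewrite TE -EFinM add0r mulrA.
rewrite sumEFin lee_fin -mulr_suml ler_wpM2r//.
under eq_bigr do rewrite mulrC.
exact: sum_poisson_pmf_mean_le.
Qed.

End poisson_mean.

Section log_modulus.
Context {R : realType} (K eps : R).
Hypotheses (K_ge0 : 0 <= K) (eps_gt0 : 0 < eps).

Definition log_modulus j : R := ln (Cconst K eps j).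

Lemma Cconst_ge1 j : 1 <= Cconst K eps j.
Proof. by rewrite /Cconst lerDl divr_ge0 ?mulr_ge0// ltW. Qed.

Lemma Cconst_gt0 j : 0 < Cconst K eps j.
Proof. exact: lt_le_trans (Cconst_ge1 j). Qed.

Lemma log_modulus_ge0 j : 0 <= log_modulus j.
Proof. by rewrite ln_ge0// Cconst_ge1. Qed.

Lemma powR_Cconst j (a : R) : Cconst K eps j `^ a = expR (a * log_modulus j).
Proof. by rewrite /powR gt_eqF// Cconst_gt0. Qed.

(** Since [F] is at least [eps], adding [j%:R * K] multiplies it by at most [1 + j%:R * K / eps],
    which is [Cconst K eps j]. *)
Lemma log_increments_bounded (F : nat -> R) :
  (forall x, eps <= F x) -> (forall x j, `|F (x + j)%N - F x| <= j%:R * K) ->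
  bounded_increments log_modulus (fun x => ln (F x / eps)).
Proof.
move=> Feps FK x j.
have Fpos y : 0 < F y by exact: lt_le_trans (Feps y).
have jK0 : 0 <= j%:R * K by rewrite mulr_ge0.
have ratio y z : F y <= F z + j%:R * K -> ln (F y / eps) - ln (F z / eps) <= log_modulus j.
  move=> yz; rewrite -ln_div ?posrE ?divr_gt0// ler_ln ?posrE ?divr_gt0 ?Cconst_gt0//.
  rewrite invf_div mulrA divfK ?gt_eqF//.
  rewrite ler_pdivrMr// (le_trans yz)// /Cconst mulrDl mul1r lerD2l.
  by rewrite mulrAC ler_pdivlMr// ler_wpM2l.
rewrite ler_norml; have := FK x j; rewrite ler_norml => /andP[F1 F2].
have r1 : F x <= F (x + j)%N + j%:R * K by lra.
have r2 : F (x + j)%N <= F x + j%:R * K by lra.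
by have := ratio _ _ r1; have := ratio _ _ r2; lra.
Qed.

End log_modulus.

Lemma lipschitz_natP (R : realType) (K : R) (f : nat -> R) x j :
  lipschitz_nat K f -> `|f (x + j)%N - f x| <= j%:R * K.
Proof.
move=> fK; elim: j => [|j IH]; first by rewrite addn0 subrr normr0 mul0r.
rewrite addnS -natr1 mulrDl mul1r.
have -> : f (x + j).+1 - f x = (f (x + j)%N - f x) + (f (x + j).+1 - f (x + j)%N) by ring.
by apply: le_trans (ler_normD _ _) _; rewrite lerD.
Qed.

(** * Deviation bound at a fixed exponent *)

Section deviation.
Context {R : realType} (lambda : R) (Q : probability nat R) (mu : probability nat R).
Hypothesis lambda_gt0 : 0 < lambda.
Hypothesis mu_CP : is_compound_poisson lambda Q mu.
Variables (K eps q : R) (f : nat -> R).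
Hypotheses (K_ge0 : 0 <= K) (eps_gt0 : 0 < eps) (f_lip : lipschitz_nat K f).
Hypothesis qE : (\int[Q]_j (j%:R)%:E = q%:E)%E.

Let mean := \int[mu]_z f z.
Let T := 2 * `|f 0%N| + 2 * K * lambda * q + eps.

Let id_int : mu.-integrable setT (EFin \o (fun z => z%:R)).
Proof.
apply/integrableP; split => //.
rewrite (eq_integral (fun z => (z%:R)%:E)); last by move=> z _ /=; rewrite ger0_norm.
exact: le_lt_trans (compound_poisson_mean_le lambda_gt0 mu_CP qE) (ltry _).
Qed.

Let bound_int : mu.-integrable setT (EFin \o (fun z => `|f 0%N| + K * z%:R)).
Proof.
apply: integrableD_EFin => //; last exact: integrableZl_EFin.
exact: finite_measure_integrable_cst.
Qed.

Let f_le z : `|f z| <= `|f 0%N| + K * z%:R.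
Proof.
have := lipschitz_natP 0 z f_lip; rewrite add0n mulrC => fz.
rewrite -[f z](subrK (f 0%N)) (le_trans (ler_normD _ _))// addrC lerD2l.
exact: fz.
Qed.

Lemma integrable_lipschitz : mu.-integrable setT (EFin \o f).
Proof.
apply: le_integrable bound_int => // z _ /=; rewrite lee_fin.
by rewrite (le_trans (f_le z))// ler_norm.
Qed.

Lemma threshold_gt0 : 0 < T.
Proof.
have q0 : 0 <= q by rewrite -lee_fin -qE; apply: integral_ge0 => j _; rewrite lee_fin.
by rewrite /T ltr_wpDl// addr_ge0// !mulr_ge0// ltW.
Qed.

Let mean_norm_le : \int[mu]_z `|f z| <= `|f 0%N| + K * lambda * q.
Proof.
apply: (@le_trans _ _ (\int[mu]_z (`|f 0%N| + K * z%:R))).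
  by apply: le_Rintegral => //; exact: integrable_norm integrable_lipschitz.
rewrite RintegralD//; [|exact: finite_measure_integrable_cst|exact: integrableZl_EFin].
rewrite Rintegral_probability_cst lerD2l RintegralZl// -mulrA ler_wpM2l//.
rewrite -lee_fin /Rintegral fineK; last exact: integrable_fin_num id_int.
exact: (compound_poisson_mean_le lambda_gt0 mu_CP qE).
Qed.

Let deviation_int : mu.-integrable setT (EFin \o (fun z => `|f z - mean| + eps)).
Proof.
apply: integrableD_EFin => //; last exact: finite_measure_integrable_cst.
apply: integrable_norm; apply: integrableB_EFin => //; first exact: integrable_lipschitz.
exact: finite_measure_integrable_cst.
Qed.

(** The triangle inequality yields twice the mean of the absolute value of [f], whence the factor 2
    in the threshold. *)
Let mean_deviation_le : \int[mu]_z (`|f z - mean| + eps) <= T.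
Proof.
have fi := integrable_lipschitz.
have ni := integrable_norm fi.
apply: (@le_trans _ _ (\int[mu]_z (`|f z| + (`|mean| + eps)))).
  apply: le_Rintegral => //.
    by apply: integrableD_EFin => //; exact: finite_measure_integrable_cst.
  by move=> z _; rewrite addrA lerD2r; exact: ler_normB.
rewrite RintegralD//; last exact: finite_measure_integrable_cst.
rewrite Rintegral_probability_cst /T.
have : `|mean| <= \int[mu]_z `|f z| by exact: le_normr_Rintegral.
by have := mean_norm_le; lra.
Qed.

Lemma compound_poisson_deviation (a t : R) : 0 < t -> 0 < a ->
  Q.-integrable setT (EFin \o log_modulus K eps) ->
  Q.-integrable setT (EFin \o (fun j => expR_rem (a * log_modulus K eps j))) ->
  (mu [set z | (t < `|f z - mean|)%R] <=
   (expR (rate Q lambda (log_modulus K eps) a + a * ln (T / t)))%:E)%E.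
Proof.
move=> t0 a0 c_int rem_int.
have T0 := threshold_gt0.
pose F z := `|f z - mean| + eps.
have Feps z : eps <= F z by rewrite lerDr.
have F0 z : 0 < F z by exact: lt_le_trans (Feps z).
pose g z := ln (F z / eps).
have g0 z : 0 <= g z by rewrite ln_ge0// ler_pdivlMr// mul1r.
have gc : bounded_increments (log_modulus K eps) g.
  apply: log_increments_bounded => // x j.
  rewrite /F [X in `|X|](_ : _ = `|f (x + j)%N - mean| - `|f x - mean|); last by ring.
  apply: le_trans (ler_dist_dist _ _) _.
  rewrite [X in `|X|](_ : _ = f (x + j)%N - f x); last by ring.
  exact: lipschitz_natP.
have gm : (\int[mu]_z (g z)%:E <= (ln (T / eps))%:E)%E.
  (* The tangent to the logarithm at [T], with [eps] as unit. As the mean of [F] is at most [T], the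
     mean of [h] is at most [ln (T / eps)]. *)
  pose h z := ln (T / eps) - 1 + T^-1 * F z.
  have hi : mu.-integrable setT (EFin \o h).
    apply: integrableD_EFin => //; last exact: integrableZl_EFin deviation_int.
    exact: finite_measure_integrable_cst.
  have gh z : g z <= h z.
    rewrite /g /h [F z / eps](_ : _ = (T / eps) * (1 + (T^-1 * F z - 1))); last first.
      by field; rewrite !gt_eqF.
    rewrite lnM ?posrE ?divr_gt0//; last by rewrite addrC subrK mulr_gt0// invr_gt0.
    have u1 : -1 < T^-1 * F z - 1 by rewrite ltrBrDr addNr mulr_gt0// invr_gt0.
    by have := le_ln1Dx u1; lra.
  apply: (@le_trans _ _ (\int[mu]_z (h z)%:E)%E).
    apply: ge0_le_integral => //; last by move=> z _; rewrite lee_fin.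
    by move=> z _; rewrite lee_fin.
  rewrite -(fineK (integrable_fin_num _ hi))//.
  rewrite lee_fin -[leLHS]/(\int[mu]_z h z) RintegralD//; last 2 first.
  - exact: finite_measure_integrable_cst.
  - exact: integrableZl_EFin deviation_int.
  rewrite Rintegral_probability_cst RintegralZl//.
  have : T^-1 * \int[mu]_z F z <= 1.
    by rewrite mulrC ler_pdivrMr// mul1r; exact: mean_deviation_le.
  lra.
have := compound_poisson_mgf lambda_gt0 mu_CP c_int (ltW a0) rem_int gc g0 gm.
rewrite -/(rate Q lambda (log_modulus K eps) a) => mgf.
pose A := [set z | (t < `|f z - mean|)%R].
(* A lower bound for [expR (a * g z)] on [A], where [F z] exceeds [t]; in the quotient by [v] the
   unit [eps] cancels and [T / t] remains. *)
pose v := expR (a * ln (t / eps)).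
have markov : (v%:E * mu A <= \int[mu]_z (expR (a * g z))%:E)%E.
  rewrite -integral_cst//; apply: (@le_trans _ _ (\int[mu]_(z in A) (expR (a * g z))%:E)%E).
    apply: ge0_le_integral => //.
    - by move=> z _; rewrite lee_fin expR_ge0.
    - move=> z; rewrite /A/= => tz; rewrite lee_fin ler_expR ler_pM2l//.
      rewrite ler_ln ?posrE ?divr_gt0// ler_pM2r ?invr_gt0//.
      by rewrite /F (le_trans (ltW tz))// lerDl ltW.
  apply: ge0_subset_integral => //.
have v0 : 0 < v by exact: expR_gt0.
rewrite -(@lee_pmul2l _ v%:E)//; apply: (le_trans markov); apply: (le_trans mgf).
rewrite -EFinM lee_fin /v -expRD ler_expR.
rewrite [T / t](_ : _ = (T / eps) / (t / eps)); last by field; rewrite !gt_eqF.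
by rewrite [ln (T / eps / (t / eps))]ln_div ?posrE ?divr_gt0//; lra.
Qed.

End deviation.

(** * Series over positive integers as integrals against the jump law *)

Section positive_support.
Context {R : realType} (Q : probability nat R).
Hypothesis Q_pos : Q [set 0%N] = 0%E.
Implicit Types (F : nat -> R) (a tau : R).

Lemma series_prob_mass F : (forall j, 0 <= F j) ->
  (\sum_(1 <= j <oo) (prob_mass Q j * F j)%:E = \int[Q]_j (F j)%:E)%E.
Proof.
move=> F0; rewrite ge0_integral_nat; last by move=> j; rewrite lee_fin.
rewrite nneseries_recl//; last by move=> j _; rewrite mule_ge0// lee_fin.
rewrite [X in (_ * X + _)%E](_ : _ = 0%E); last exact: Q_pos.
rewrite mule0 add0e; apply: eq_eseriesr => j _.
by rewrite EFinM muleC /prob_mass fineK// fin_num_measure.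
Qed.

Lemma momentE tau : moment Q tau = (\int[Q]_j (j%:R `^ tau)%:E)%E.
Proof.
rewrite -series_prob_mass; last by move=> j; exact: powR_ge0.
by apply: eq_eseriesr => j _; rewrite mulrC.
Qed.

Lemma ex_positive_mass : exists2 j, (0 < j)%N & (0 < Q [set j])%E.
Proof.
apply: contrapT => noj.
have Q0 j : Q [set j] = 0%E.
  case: j => [//|j]; apply/eqP; rewrite eq_le measure_ge0 andbT leNgt.
  by apply/negP => Qj; apply: noj; exists j.+1.
have : (\int[Q]_j (1%:E : \bar R) = 0)%E.
  by rewrite ge0_integral_nat// eseries0// => j _ _; rewrite mul1e; exact: Q0.
rewrite integral_cst// mul1e -[X in X = _]/(Q setT) probability_setT => /eqP.
by rewrite onee_eq0.
Qed.

Lemma lt_moment_order a : (a%:E < moment_order Q)%E ->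
  exists tau, [/\ 1 <= tau, a < tau &
    Q.-integrable setT (EFin \o (fun j => j%:R `^ tau))].
Proof.
move=> /ereal_sup_gt[_ [tau [tau1 mtau] <-]]; rewrite lte_fin => atau.
exists tau; split => //; apply/integrableP; split => //.
rewrite (eq_integral (fun j => (j%:R `^ tau)%:E)) -?momentE// => j _ /=.
by rewrite ger0_norm// powR_ge0.
Qed.

Variables (lambda K eps : R).
Hypotheses (lambda_gt0 : 0 < lambda) (K_ge0 : 0 <= K) (eps_gt0 : 0 < eps).
Let c := log_modulus K eps.

(** For [j >= 1], [Cconst K eps j] is at most [j%:R * (1 + K / eps)], so a finite moment of order
    [tau > a] suffices; the summand 1 in the dominating function covers [j = 0]. *)
Lemma integrable_exp_modulus a : (a%:E < moment_order Q)%E ->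
  Q.-integrable setT (EFin \o (fun j => expR (a * c j))).
Proof.
move=> /lt_moment_order[tau [tau1 atau itau]].
pose B := (1 + K / eps) `^ tau.
apply: (@le_integrable _ _ _ _ _ _ _ (EFin \o (fun j => 1 + B * j%:R `^ tau))) => //.
  move=> j _ /=; rewrite lee_fin !ger0_norm ?expR_ge0 ?addr_ge0 ?mulr_ge0 ?powR_ge0//.
  have tau0 : 0 <= tau by apply: le_trans tau1.
  apply: (@le_trans _ _ (expR (tau * c j))).
    by rewrite ler_expR ler_wpM2r ?log_modulus_ge0// ltW.
  case: j => [|j].
    rewrite /c /log_modulus /Cconst !mul0r addr0 ln1 mulr0 expR0 lerDl.
    by rewrite mulr_ge0// powR_ge0.
  rewrite -powR_Cconst// (@le_trans _ _ (B * j.+1%:R `^ tau)) ?lerDr//.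
  have Ke0 : 0 <= K / eps by rewrite divr_ge0// ltW.
  rewrite /B -powRM//; last by rewrite addr_ge0.
  apply: ge0_ler_powR => //; rewrite ?nnegrE ?mulr_ge0 ?addr_ge0//.
    by rewrite divr_ge0 ?mulr_ge0// ltW.
  by rewrite /Cconst mulrDl mul1r lerD ?ler1n// mulrAC [leRHS]mulrC mulrA [leLHS]mulrAC.
apply: integrableD_EFin => //; last exact: integrableZl_EFin.
exact: finite_measure_integrable_cst.
Qed.

Lemma IepsE : Ieps lambda Q K eps = rate Q lambda c.
Proof.
apply/funext => a; rewrite /Ieps /rate /Rintegral -series_prob_mass; last first.
  by move=> j; exact: expR_rem_ge0.
congr (_ * fine _); apply: eq_eseriesr => j _.
by rewrite powR_Cconst.
Qed.

Lemma rate_slopeE a : 0 <= a -> rate_slope Q lambda c a =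
  lambda * fine (\sum_(1 <= j <oo)
    (prob_mass Q j * ((Cconst K eps j `^ a - 1) * ln (Cconst K eps j)))%:E)%E.
Proof.
move=> a0; rewrite series_prob_mass; last first.
  move=> j; rewrite powR_Cconst// mulr_ge0 ?log_modulus_ge0// subr_ge0.
  by rewrite -expR0 ler_expR mulr_ge0// log_modulus_ge0.
by congr (_ * fine _); apply: eq_integral => j _; rewrite powR_Cconst.
Qed.

Hypothesis L_gt1 : (1 < moment_order Q)%E.

Lemma moment_order_gt0 : (0 < moment_order Q)%E.
Proof. exact: lt_trans L_gt1. Qed.

Lemma first_momentE : (\int[Q]_j (j%:R)%:E = (first_moment Q)%:E)%E.
Proof.
have mE : moment Q 1 = (\int[Q]_j (j%:R)%:E)%E.
  by rewrite momentE; apply: eq_integral => j _; rewrite powRr1.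
rewrite /first_moment mE fineK//.
have [tau [tau1 _ itau]] := lt_moment_order L_gt1.
apply: integrable_fin_num => //.
apply: le_integrable itau => // j _ /=; rewrite lee_fin !ger0_norm ?powR_ge0//.
case: j => [|j]; first exact: powR_ge0.
by rewrite -[leLHS]powRr1// ler_powR// ler1n.
Qed.

Lemma iepsE a : (a%:E < moment_order Q)%E ->
  derivable (Ieps lambda Q K eps) a 1 /\
  ieps lambda Q K eps a = rate_slope Q lambda c a.
Proof.
move=> aL; rewrite /ieps IepsE derive1E.
have dI := rate_is_derive (ltW lambda_gt0) (log_modulus_ge0 K_ge0 eps_gt0)
  integrable_exp_modulus moment_order_gt0 aL.
by split; [exact: ex_derive|exact: derive_val].
Qed.

Lemma ieps_invE s :
  ieps_inv lambda Q K eps s = slope_inv (rate_slope Q lambda c) (moment_order Q) s.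
Proof.
rewrite /ieps_inv /slope_inv; congr ereal_sup; apply/seteqP; split => _ [a [a0 aL ia] <-];
  exists a => //; split => //; move: ia; by rewrite (iepsE aL).2.
Qed.

(** Some [j > 0] carries mass, and [0 < K] makes its log-modulus positive; the slope is then
    strictly increasing, so no [b > a] enters the supremum. *)
Lemma ieps_invK a : 0 < K -> 0 <= a -> (a%:E < moment_order Q)%E ->
  ieps_inv lambda Q K eps (ieps lambda Q K eps a) = a%:E.
Proof.
move=> K0 a0 aL; rewrite ieps_invE (iepsE aL).2.
have [j j0 Qj] := ex_positive_mass.
have cj : 0 < c j by rewrite ln_gt0// /Cconst ltrDl divr_gt0// mulr_gt0// ltr0n.
apply/eqP; rewrite eq_le; apply/andP; split; last first.
  by apply: ereal_sup_ubound; exists a.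
apply: ge_ereal_sup => _ [b [b0 bL ib] <-]; rewrite lee_fin leNgt; apply/negP => ab.
have := rate_slope_lt (log_modulus_ge0 K_ge0 eps_gt0) integrable_exp_modulus
  moment_order_gt0 lambda_gt0 Qj cj ab bL.
by rewrite ltNge ib.
Qed.

End positive_support.

(** * Tail bounds for Lipschitz functions of [Z] *)

Theorem theorem3 (R : realType) (d : measure_display) (T : measurableType d)
    (P : probability T R) (Z : {RV P >-> nat})
    (lambda : R) (Q : probability nat R)
    (lambda_gt0 : 0 < lambda)
    (Q_pos : Q [set 0%N] = 0%E)
    (Z_CP : is_compound_poisson lambda Q (distribution P Z))
    (L_gt1 : (1 < moment_order Q)%E)
    (K : R) (f : nat -> R) (f_lip : lipschitz_nat K f)
    (t eps : R) (t_gt0 : 0 < t) (eps_gt0 : 0 < eps) :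
  let deviation :=
    P [set w | (t%:E < `| (f (Z w))%:E - 'E_P[f \o Z] |)%E] in
  (* (i) *)
  (deviation <= polynomial_bound lambda Q K eps f t)%E /\
  (* (ii) *)
  [/\ (polynomial_bound lambda Q K eps f t < 1)%E <->
        threshold lambda Q K eps f < t,
      forall alpha : R, 0 < alpha -> (alpha%:E < moment_order Q)%E ->
        derivable (Ieps lambda Q K eps) alpha 1 /\
        ieps lambda Q K eps alpha =
          lambda * fine (\sum_(1 <= j <oo)
            (prob_mass Q j * ((Cconst K eps j `^ alpha - 1)
                              * ln (Cconst K eps j)))%:E)%E,
      0 < K -> forall alpha : R,
        0 <= alpha -> (alpha%:E < moment_order Q)%E ->
        ieps_inv lambda Q K eps (ieps lambda Q K eps alpha) = alpha%:E &
      threshold lambda Q K eps f < t ->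
        (deviation <=
         expeR (- \int[lebesgue_measure]_(s in
                     `[0%R, ln (t / threshold lambda Q K eps f)])
                   ieps_inv lambda Q K eps s))%E].
Proof.
move=> deviation.
have K_ge0 : 0 <= K by exact: le_trans (f_lip 0%N).
pose c := log_modulus K eps.
have c_ge0 := log_modulus_ge0 K_ge0 eps_gt0.
have exp_int := integrable_exp_modulus Q_pos K_ge0 eps_gt0.
have L_gt0 := moment_order_gt0 L_gt1.
have qE := first_momentE Q_pos L_gt1.
have IE := IepsE Q_pos lambda K_ge0 eps_gt0.
set th := threshold lambda Q K eps f.
have th0 : 0 < th by exact: (threshold_gt0 lambda_gt0 f K_ge0 eps_gt0 qE).
pose mu : probability nat R := distribution P Z.
have fi := integrable_lipschitz lambda_gt0 (mu := mu) Z_CP f_lip qE.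
have EE : ('E_P[f \o Z] = (\int[mu]_z f z)%R%:E)%E.
  rewrite unlock /Rintegral fineK; last exact: integrable_fin_num fi.
  rewrite integral_distribution//; apply/integrableP; split.
    by apply: (@measurableT_comp _ _ _ _ _ _ (EFin \o f)).
  have /integrableP[_] := fi.
  by rewrite (@ge0_integral_distribution _ _ _ _ _ _ Z (fun z => `|(f z)%:E|%E)).
have deviationE : deviation = mu [set z | (t < `|f z - \int[mu]_z f z|)%R].
  by rewrite /deviation EE.
have bound a : 0 < a -> (a%:E < moment_order Q)%E ->
    (deviation <= (expR (Ieps lambda Q K eps a + a * ln (th / t)))%:E)%E.
  move=> a0 aL; rewrite deviationE IE.
  apply: (compound_poisson_deviation lambda_gt0 Z_CP K_ge0 eps_gt0 f_lip qE t_gt0 a0).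
    exact: integrable_modulus c_ge0 exp_int L_gt0.
  exact: integrable_rem c_ge0 exp_int L_gt0 a aL.
set x := ln (t / th).
have lnx : ln (th / t) = - x by rewrite /x !ln_div ?posrE// opprB.
pose S := [set (Ieps lambda Q K eps a + a * ln (th / t))%:E | a in
  [set a : R | 0 < a /\ (a%:E < moment_order Q)%E]].
have part1 : (deviation <= polynomial_bound lambda Q K eps f t)%E.
  rewrite /polynomial_bound -/th -/S.
  have dev0 : (0 <= deviation)%E by exact: measure_ge0.
  (* Writing the probability as [expeR y] moves the comparison to the exponents, where the infimum
     is taken. *)
  have [y yE] := expeR_total dev0; rewrite -yE lee_expeR.
  apply: le_ereal_inf_tmp => _ [a [a0 aL] <-].
  by rewrite -lee_expeR yE; exact: bound.
have rsmall := rate_small (ltW lambda_gt0) c_ge0 exp_int L_gt0.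
have x_gt0 : (0 < x) = (th < t).
  by rewrite /x -[X in X < _]ln1 ltr_ln ?posrE ?divr_gt0// ltr_pdivlMr// mul1r.
split => //; split.
- rewrite /polynomial_bound -/th -/S -[X in (_ < X)%E]expeR0 lte_expeR -x_gt0; split.
    (* If [x <= 0], every exponent is a sum of two nonnegative terms. *)
    move=> S0; rewrite ltNge; apply/negP => x0; move: S0; apply/negP; rewrite -leNgt.
    apply: le_ereal_inf_tmp => _ [a [a0 aL] <-].
    rewrite lee_fin lnx IE; apply: addr_ge0; first exact: (rate_ge0 _ _ (ltW lambda_gt0)).
    by rewrite mulr_ge0 ?oppr_ge0// ltW.
  (* Half of [x] pays for the rate, leaving an exponent of at most [- (a * x / 2)]. *)
  move=> x0; have [a [a0 aL Ia]] := rsmall (x / 2) (divr_gt0 x0 (ltr0Sn _ 1)).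
  apply: (@le_lt_trans _ _ (Ieps lambda Q K eps a + a * ln (th / t))%:E).
    by apply: ereal_inf_lbound; exists a.
  rewrite lte_fin lnx IE; have := mulr_gt0 a0 x0; lra.
- move=> a a0 aL; have [dI ->] := iepsE Q_pos lambda_gt0 K_ge0 eps_gt0 L_gt1 aL.
  by split => //; rewrite rate_slopeE// ltW.
- by move=> K0 a a0 aL; exact: ieps_invK.
(* It suffices to bound the integral by the Legendre transform at [x], which is minus the infimum in
   part (i). *)
- rewrite -x_gt0 => x0; apply: le_trans part1 _.
  rewrite /polynomial_bound -/th -/S lee_expeR leeNr.
  have -> : (\int[lebesgue_measure]_(s in `[0%R, x]) ieps_inv lambda Q K eps s =
    \int[lebesgue_measure]_(s in `[0%R, x])
      slope_inv (rate_slope Q lambda c) (moment_order Q) s)%E.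
    by apply: eq_integral => s _; exact: ieps_invE.
  have tangent := rate_tangent (ltW lambda_gt0) c_ge0 exp_int L_gt0.
  apply: le_trans (integral_slope_inv_le tangent rsmall L_gt0 (rate_slope0 Q lambda c) x0) _.
  apply: ge_ereal_sup => _ [a [a0 aL] <-]; rewrite leeNr.
  apply: ereal_inf_lbound; exists a => //.
  by rewrite lnx IE -EFinN; congr EFin; rewrite /c; ring.
Qed.
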